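(* For each positive integer $\kappa\geq 1$ and each sequence $\vec{p}$ of integers $\geq 2$, $S(\Lambda_{\kappa},\vec{p})$ is $\frac{1}{\kappa+1}$-homogeneous.
   Context: For a cardinal $\kappa\ge 1$, a space $Y$ is $\frac1\kappa$-homogeneous if the action of its homeomorphism group $\operatorname{Homeo}(Y)$ on $Y$ has exactly $\kappa$ orbits. The standard long line $[0,\omega_1)$ is obtained from the ordinal $\omega_1$ by putting a copy of the open unit interval $(0,1)$ between $\alpha$ and $\alpha+1$ for each $\alpha\in\omega_1$, with the natural order topology; the standard closed long line $[0,\omega_1]$ adds $\omega_1$ as a last (compactifying) point. The ordered continua $\Lambda_n$, $n\ge1$, are defined inductively: $\Lambda_1=[0,\omega_1]$ is the standard closed long line; given $\Lambda_n$, let $\Lambda_n^-$ be $\Lambda_n$ minus its right endpoint (last point), and let $\Lambda_{n+1}$ be the two-point compactification $\{-\infty\}\cup(\mathbb{Z}\times\Lambda_n^-)\cup\{\infty\}$ of $\mathbb{Z}\times\Lambda_n^-$, where $\mathbb{Z}\times\Lambda_n^-$ has the lexicographic order and order topology, and $-\infty$ and $\infty$ are added as first and last points. An ordered continuum is a nondegenerate compact connected space $\Lambda$ which has a linear order and whose topology is the order topology; $\partial\Lambda$ is the set consisting of its first and last points. For $n\ge 1$, $\Lambda^{(n)}$ denotes $n$ copies of $\Lambda$ laid end to end (the last point of each copy is identified with the first point of the next, orders preserved), and $\Sigma^{(n)}=\Lambda^{(n)}/\partial\Lambda^{(n)}$ is the ''circle'' obtained by identifying the first and last points of $\Lambda^{(n)}$;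 $\Sigma=\Sigma^{(1)}$. The identified endpoints of the copies of $\Lambda$ in $\Sigma^{(n)}$ are labeled in cyclic order $\infty_0,\dots,\infty_{n-1}$, and for $x\in\Lambda\setminus\partial\Lambda$, $\infty_i+x$ denotes the copy of $x$ in the $i$th copy of $\Lambda$ (the one starting at $\infty_i$). For positive integers $m,n$ the $m$-fold covering map $\phi^m_n:\Sigma^{(mn)}\to\Sigma^{(n)}$ is given by $\phi^m_n(\infty_i)=\infty_j$ and $\phi^m_n(\infty_i+x)=\infty_j+x$, where $j=i \bmod n$. For a sequence $\vec{p}=\langle p_1,p_2,\dots\rangle$ of positive integers, put $k(1)=1$ and $k(n)=p_1p_2\cdots p_{n-1}$ for $n>1$, and let $S(\Lambda,\vec{p})=\varprojlim\{\phi^{p_n}_{k(n)},\Sigma^{(k(n))},n\in\mathbb{N}\}$, the inverse limit with bonding maps $\phi^{p_n}_{k(n)}:\Sigma^{(k(n+1))}\to\Sigma^{(k(n))}$. *)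

(* Defs.v *)
From HB Require Import structures.
From mathcomp Require Import all_boot all_order all_algebra.
From mathcomp Require Import wochoice all_classical all_reals all_analysis.

Set Implicit Arguments.
Unset Strict Implicit.
Unset Printing Implicit Defensive.
Import Order.TTheory.

Local Open Scope order_scope.
Local Open Scope classical_set_scope.
Local Open Scope quotient_scope.
Local Open Scope card_scope.

(* A space is [1/#K]-homogeneous when the orbits of its homeomorphism group
   are equinumerous with [K]; the cardinal is represented by the set [K]. *)

Definition Homeo (Y : topologicalType) : set (Y -> Y) :=
  [set f | exists g, [/\ cancel f g, cancel g f, continuous f & continuous g]].
Arguments Homeo Y : clear implicits.

Definition homeo_orbit (Y : topologicalType) (y : Y) : set Y :=
  [set f y | f in Homeo Y].

Definition homeo_orbits (Y : topologicalType) : set (set Y) :=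
  range (@homeo_orbit Y).
Arguments homeo_orbits Y : clear implicits.

Definition recip_homogeneous (U : Type) (K : set U) (Y : topologicalType) :=
  homeo_orbits Y #= K.

(* Every linear order below carries this one display, so that the recursion
   defining [Lambda] stays in a single type of linear orders. *)
Fact long_display : Order.disp_t. Proof. exact: (Order.Disp tt tt). Qed.

(* The ordinal omega_1: well-order the uncountable type [set nat] and keep the
   elements with countably many predecessors. *)

Definition wo_le : rel (set nat) := sval (well_ordering_principle (set nat)).

Lemma wo_leP : well_order wo_le.
Proof. exact: (svalP (well_ordering_principle (set nat))). Qed.

Lemma wo_le_chain : wo_chain wo_le predT.
Proof. by move=> A _; exact: wo_leP. Qed.

Lemma wo_le_refl : reflexive wo_le.
Proof. by move=> x; exact: (wo_chain_reflexive wo_le_chain). Qed.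

Lemma wo_le_anti : antisymmetric wo_le.
Proof. by move=> x y xy; exact: (wo_chain_antisymmetric wo_le_chain). Qed.

Lemma wo_le_total : total wo_le.
Proof. by move=> x y; exact: (wo_chainW wo_le_chain). Qed.

Lemma wo_le_trans : transitive wo_le.
Proof.
move=> y x z xy yz.
have [|m [[mA mle] _]] := wo_leP (A := pred3 x y z).
  by exists x; rewrite !inE eqxx.
have le3 w : w \in pred3 x y z -> wo_le m w by exact: mle.
move: mA; rewrite !inE => /or3P[] /eqP mE; subst m.
- by apply: le3; rewrite !inE eqxx !orbT.
- have yx : wo_le y x by apply: le3; rewrite !inE eqxx.
  by have -> : x = y by apply: wo_le_anti; rewrite xy yx.
- have zy : wo_le z y by apply: le3; rewrite !inE eqxx !orbT.
  by have <- : y = z by apply: wo_le_anti; rewrite yz zy.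
Qed.

Definition omega1 : Type :=
  {x : set nat | `[< countable [set y | wo_le y x] >]}.

HB.instance Definition _ := [isSub of omega1 for @sval _ _].
HB.instance Definition _ := [Choice of omega1 by <:].

Definition omega1_le : rel omega1 := fun a b => wo_le (val a) (val b).

Lemma omega1_le_refl : reflexive omega1_le.
Proof. by move=> a; exact: wo_le_refl. Qed.

Lemma omega1_le_anti : antisymmetric omega1_le.
Proof. by move=> a b ab; apply: val_inj; exact: wo_le_anti. Qed.

Lemma omega1_le_trans : transitive omega1_le.
Proof. by move=> b a c; exact: wo_le_trans. Qed.

Lemma omega1_le_total : total omega1_le.
Proof. by move=> a b; exact: wo_le_total. Qed.

HB.instance Definition _ := Order.Le_isPOrder.Build long_display omega1
  omega1_le_refl omega1_le_anti omega1_le_trans.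
HB.instance Definition _ := Order.POrder_isTotal.Build long_display omega1
  omega1_le_total.

(* The three facts that characterize omega_1 up to order isomorphism. *)

Lemma omega1_well_ordered (A : set omega1) :
  A !=set0 -> exists2 a, A a & forall b, A b -> a <= b.
Proof.
move=> [a Aa].
have [|m [[+ mle] _]] := wo_leP (A := [pred x | `[< exists2 b, A b & val b = x >]]).
  by exists (val a); rewrite inE; exists a.
rewrite inE => -[b Ab bm]; exists b => // c Ac.
change (wo_le (val b) (val c)); rewrite bm; apply: mle.
by rewrite inE; exists c.
Qed.

Lemma omega1_countable_initial (a : omega1) : countable [set b | b <= a].
Proof.
have /asboolP/countable_injP[f finj] := valP a.
apply/countable_injP; exists (fun b => f (val b)) => b c.
by rewrite !inE => ba ca fbc; apply: val_inj; apply: finj; rewrite ?inE.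
Qed.

Lemma omega1_uncountable : ~ countable [set: omega1].
Proof.
move=> /countable_injP[f finj].
have Ccount : countable [set x | countable [set y | wo_le y x]].
  pose g (x : set nat) : nat := if insub x is Some a then f (a : omega1) else 0.
  apply/countable_injP; exists g => x y; rewrite !inE /g => xC yC.
  case: insubP => [a _ ax|/asboolP//]; case: insubP => [b _ by_|/asboolP//].
  by move=> /finj; rewrite !inE => /(_ I I) ab; rewrite -ax -by_ ab.
have [[x xC]|/forallNP allC] :=
    pselect (exists x, ~ countable [set y | wo_le y x]); last first.
  move: Ccount => /countable_injP[g ginj].
  have ginj' : injective g.
    by move=> x y; apply: ginj; apply: mem_set; apply: contrapT; exact: allC.
  pose D : set nat := [set n | exists2 A, g A = n & ~ A n].
  have [DD|nDD] := pselect (D (g D)); last first.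
    by apply: (nDD); exists D.
  by have [A /ginj' AD nA] := DD; apply: nA; rewrite AD.
have [|m [[+ mle] _]] :=
    wo_leP (A := [pred x | `[< ~ countable [set y | wo_le y x] >]]).
  by exists x; rewrite inE.
rewrite inE; apply.
apply: (@sub_countable _ _ _
    ([set x | countable [set y | wo_le y x]] `|` [set m])); last first.
  rewrite -bigcup2E; apply: bigcup_countable => // -[|[|i]] _ //=.
apply: subset_card_le => y /= ym.
have [|yC] := pselect (countable [set z | wo_le z y]); first by left.
by right; apply: wo_le_anti; rewrite ym mle ?inE.
Qed.

(* [adjoin_last T] is [T] with a last point [None] added, [adjoin_first T] is
   [T] with a first point [None] added. *)

Section adjoin_last.
Context (d : Order.disp_t) (T : orderType d).

Definition adjoin_last : Type := option T.

HB.instance Definition _ := Choice.on adjoin_last.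

Definition adjoin_last_le : rel adjoin_last := fun a b =>
  match a, b with
  | Some x, Some y => x <= y
  | _, None => true
  | None, Some _ => false
  end.

Fact adjoin_last_refl : reflexive adjoin_last_le.
Proof. by case=> /=. Qed.

Fact adjoin_last_anti : antisymmetric adjoin_last_le.
Proof. by move=> [x|] [y|] //= /le_anti ->. Qed.

Fact adjoin_last_trans : transitive adjoin_last_le.
Proof. by move=> [y|] [x|] [z|] //=; exact: le_trans. Qed.

Fact adjoin_last_total : total adjoin_last_le.
Proof. by move=> [x|] [y|] //=; exact: le_total. Qed.

HB.instance Definition _ := Order.Le_isPOrder.Build d adjoin_last
  adjoin_last_refl adjoin_last_anti adjoin_last_trans.
HB.instance Definition _ := Order.POrder_isTotal.Build d adjoin_last
  adjoin_last_total.

Fact adjoin_last_top (a : adjoin_last) : a <= (None : adjoin_last).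
Proof. by case: a. Qed.

HB.instance Definition _ := Order.hasTop.Build d adjoin_last adjoin_last_top.

End adjoin_last.

Section adjoin_first.
Context (d : Order.disp_t) (T : tOrderType d).

Definition adjoin_first : Type := option T.

HB.instance Definition _ := Choice.on adjoin_first.

Definition adjoin_first_le : rel adjoin_first := fun a b =>
  match a, b with
  | Some x, Some y => x <= y
  | None, _ => true
  | Some _, None => false
  end.

Fact adjoin_first_refl : reflexive adjoin_first_le.
Proof. by case=> /=. Qed.

Fact adjoin_first_anti : antisymmetric adjoin_first_le.
Proof. by move=> [x|] [y|] //= /le_anti ->. Qed.

Fact adjoin_first_trans : transitive adjoin_first_le.
Proof. by move=> [y|] [x|] [z|] //=; exact: le_trans. Qed.

Fact adjoin_first_total : total adjoin_first_le.
Proof. by move=> [x|] [y|] //=; exact: le_total. Qed.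

HB.instance Definition _ := Order.Le_isPOrder.Build d adjoin_first
  adjoin_first_refl adjoin_first_anti adjoin_first_trans.
HB.instance Definition _ := Order.POrder_isTotal.Build d adjoin_first
  adjoin_first_total.

Fact adjoin_first_top (a : adjoin_first) : a <= (Some \top : adjoin_first).
Proof. by case: a => //= x; exact: lex1. Qed.

HB.instance Definition _ := Order.hasTop.Build d adjoin_first adjoin_first_top.

End adjoin_first.

Section minus_last.
Context (d : Order.disp_t) (T : tOrderType d).

Definition minus_last : Type := {x : T | x != \top}.

HB.instance Definition _ := [isSub of minus_last for @sval _ _].
HB.instance Definition _ := [Choice of minus_last by <:].
HB.instance Definition _ := [SubChoice_isSubOrder of minus_last by <: with d].

End minus_last.

Section unit_interval.
Context (R : realType).

Definition unit_co : Type := {t : R | (0 <= t < 1)%R}.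

HB.instance Definition _ := [isSub of unit_co for @sval _ _].
HB.instance Definition _ := [Choice of unit_co by <:].
HB.instance Definition _ :=
  [SubChoice_isSubOrder of unit_co by <: with long_display].

(* [(alpha, 0)] is the ordinal alpha, and the [(alpha, t)] with [0 < t < 1] form
   the copy of (0,1) between alpha and alpha + 1. *)
Definition long_line := omega1 *lexi[long_display] unit_co.

Definition closed_long_line : tOrderType long_display := adjoin_last long_line.

(* Lambda_(n+1) from [L] = Lambda_n: the first and last points adjoined to
   Z x L^- are -oo and oo. *)
Definition next_Lambda (L : tOrderType long_display) :
    tOrderType long_display :=
  adjoin_first (adjoin_last (int *lexi[long_display] minus_last L)).

(* Lambda_n for [n >= 1] (the value at [n = 0] is irrelevant). *)
Fixpoint Lambda (n : nat) : tOrderType long_display :=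
  match n with
  | 0 | 1 => closed_long_line
  | n'.+1 => next_Lambda (Lambda n')
  end.

End unit_interval.

(* The quotient X / A of a space by a subspace. *)

Section collapse.
Context (X : topologicalType) (A : set X).

Definition collapse_rel : rel X :=
  fun x y => (x == y) || (x \in A) && (y \in A).

Fact collapse_refl : reflexive collapse_rel.
Proof. by move=> x; rewrite /collapse_rel eqxx. Qed.

Fact collapse_sym : symmetric collapse_rel.
Proof. by move=> x y; rewrite /collapse_rel eq_sym andbC. Qed.

Fact collapse_trans : transitive collapse_rel.
Proof.
move=> y x z; rewrite /collapse_rel => /predU1P[->//|/andP[xA yA]].
by move=> /predU1P[<-|/andP[_ zA]]; rewrite xA ?yA ?zA orbT.
Qed.

Canonical collapse_equiv :=
  EquivRel collapse_rel collapse_refl collapse_sym collapse_trans.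

Definition collapse := quotient_topology {eq_quot collapse_equiv}.

HB.instance Definition _ := Topological.on collapse.

Definition to_collapse (x : X) : collapse := \pi_({eq_quot collapse_equiv}) x.

Definition of_collapse (s : collapse) : X :=
  repr (s : {eq_quot collapse_equiv}).

End collapse.

Section circles.
Context (d : Order.disp_t) (L : tOrderType d).

(* [n] copies of [L] laid end to end: the last point of the copy [i < n.-1] is
   the first point of the copy [i.+1], so that it is only kept for the last
   copy, where it is [None]. *)
Definition copies (n : nat) : Type :=
  order_topology (adjoin_last ('I_n *lexi[d] minus_last L)).

HB.instance Definition _ n := OrderTopological.on (copies n).

Lemma copies_leE (n : nat) (i j : 'I_n) (x y : minus_last L) :
  ((Some (i, x) : copies n) <= (Some (j, y) : copies n)) =
  (i <= j)%N && ((j <= i)%N ==> (x <= y)).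
Proof. by []. Qed.

Definition endpoints (n : nat) : set (copies n) :=
  [set x | (forall y, x <= y) \/ (forall y, y <= x)].

Definition Sigma (n : nat) := collapse (@endpoints n).
HB.instance Definition _ n := Topological.on (Sigma n).

(* The point [oo_i + x]; when [x] is the first point of [L], it is [oo_i]. *)
Definition circle_pt (n : nat) (i : 'I_n) (x : minus_last L) : Sigma n :=
  to_collapse (@endpoints n) (Some (i, x)).

Section covering.
Context (m n : nat).

Fact cover_ord_subproof (i : 'I_(m * n)) : (i %% n < n)%N.
Proof.
by case: n i => [|n'] [i] /=; [rewrite muln0 | move=> _; exact: ltn_pmod].
Qed.

Definition cover_ord (i : 'I_(m * n)) : 'I_n := Ordinal (cover_ord_subproof i).

Definition copies_cover (x : copies (m * n)) : copies n :=
  omap (fun ix => (cover_ord ix.1, ix.2)) x.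

(* The covering map phi^m_n, read on representatives; see [cover_circle_pt]. *)
Definition cover (s : Sigma (m * n)) : Sigma n :=
  to_collapse (@endpoints n) (copies_cover (of_collapse s)).

Lemma copies_cover_endpoints (x : copies (m * n)) :
  endpoints x -> endpoints (copies_cover x).
Proof.
case: x => [[i x]|] /=; last by move=> _; right; case.
move=> [xmin|/(_ None)//]; left => -[[j y]|//].
have mn0 : (0 < m * n)%N by exact: leq_ltn_trans (ltn_ord i).
have i0 : (i : nat) = 0.
  have := xmin (Some (Ordinal mn0, x)).
  by rewrite copies_leE leqn0 => /andP[/eqP].
have := xmin (Some (i, y)).
rewrite !copies_leE leqnn /= i0 mod0n leq0n /= => xy.
by rewrite xy implybT.
Qed.

Lemma cover_circle_pt (i : 'I_(m * n)) (x : minus_last L) :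
  cover (circle_pt i x) = circle_pt (cover_ord i) x.
Proof.
have : collapse_rel (@endpoints (m * n))
    (of_collapse (circle_pt i x)) (Some (i, x)).
  apply/(@eqmodP _ (collapse_equiv (@endpoints (m * n)))).
  by rewrite /of_collapse reprK.
rewrite /cover /circle_pt /collapse_rel => /predU1P[->//|/andP[]].
rewrite !inE => s_end ix_end.
apply/(@eqmodP _ (collapse_equiv (@endpoints n))).
apply/orP; right; apply/andP; split; apply/mem_set.
  exact: copies_cover_endpoints.
exact: (copies_cover_endpoints ix_end).
Qed.

End covering.

End circles.

(* Sequences are indexed from 0: [p n] stands for p_(n+1) and [winding p n] for
   k(n+1) = p_1 ... p_n. *)
Fixpoint winding (p : nat -> nat) (n : nat) : nat :=
  if n is n'.+1 then p n' * winding p n' else 1.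

Section solenoid.
Context (d : Order.disp_t) (L : tOrderType d) (p : nat -> nat).

Definition solenoid_set :
    set (prod_topology (fun n => Sigma L (winding p n))) :=
  [set x | forall n, cover (x n.+1 : Sigma L (p n * winding p n)) = x n].

Definition solenoid : Type := solenoid_set.
HB.instance Definition _ := Topological.on solenoid.

End solenoid.

(* Main.v *)
From mathcomp Require Import all_boot all_order all_algebra.
From mathcomp Require Import zify lra.
From mathcomp Require Import all_classical all_reals all_analysis.
From mathcomp Require Import borel_hierarchy.
Require Import Defs.

(** Let [L] be one of the continua Lambda_K.  A point of the solenoid S([L], p)
    is determined by its index sequence, an element of the inverse limit of the
    groups Z/k(n), and by its position in [L] minus the last point.  The points
    with a given index sequence form a thread, a continuous image of [L].

    Upper bound.  The translations of the group of index sequences and the order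
    automorphisms of [L], applied in all copies of [L] at once, act on the
    solenoid by homeomorphisms ([thread_homeo]).  So the orbit of a point depends
    at most on the orbit of its position under the order automorphisms of [L].
    These orbits are the level sets of a rank on [L] minus its last point: a
    point has rank n > 0 when it is the first point of one of the nested copies
    of Lambda_n, and rank 0 when it lies inside a long line.  The first point of
    Lambda_K is the only one of rank K, so the ranks are 0, ..., K.

    Lower bound.  The rank can be recovered from the topology.  A point of rank 0
    is a G_delta point of the solenoid ([thread_Gdelta]); a point of rank 1 is
    not, because along its thread it is a limit from the left of uncountable
    cofinality ([thread_not_Gdelta]).  Away from the first point of [L], the
    solenoid is locally the product of an interval with a totally disconnected
    set, so small connected sets stay on one thread ([connected_digits]) and
    reveal the order of [L]: the points of rank k + 1 > 1 are limits, along
    arbitrarily small connected sets, of points of rank k, whereas near a point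
    of positive rank all other points of the thread have smaller rank.  Hence the
    property [wild] k, which iterates this kind of limit k times starting from
    the points that are not G_delta, holds at rank k + 1 ([wild_of_rank]) and,
    for k < K, fails at rank at most k ([rank_of_wild]).

    All that this argument uses about [L] is collected in [ranked].  It is proved
    for the closed long line in [long_line_ranked], and it passes from Lambda_n
    to Lambda_(n+1) by [next_Lambda_ranked].  That the interior points of the
    long line form one orbit rests on a form of Cantor's theorem on countable
    dense orders ([order_aut_between]). *)

Set Implicit Arguments.
Unset Strict Implicit.
Unset Printing Implicit Defensive.
Import Order.TTheory GRing.Theory Num.Theory.
Local Open Scope order_scope.
Local Open Scope classical_set_scope.

(** * Order topologies *)

Definition densely_ordered d (T : orderType d) :=
  forall x y : T, x < y -> exists z, x < z < y.

Definition order_complete d (T : orderType d) :=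
  forall A : set T, exists s, ubound A s /\ lbound (ubound A) s.

Section one_sided_neighbourhoods.
Context d (T : orderType d).
Implicit Types (U : set T) (x y a b : T).

(** One-sided neighbourhoods are required only where there is a point on that
    side, so the end points of the order need no separate treatment. *)
Definition extends_left U x :=
  forall a, a < x -> exists2 b, b < x & forall y, b < y -> y <= x -> U y.

Definition extends_right U x :=
  forall a, x < a -> exists2 b, x < b & forall y, x <= y -> y < b -> U y.

Lemma order_openP (U : set (order_topology T)) :
  open U <-> forall x, U x -> extends_left U x /\ extends_right U x.
Proof.
split=> [Uo x Ux|UP].
  have : nbhs (x : order_topology T) U by exact: open_nbhs_nbhs.
  rewrite itv_nbhsE => -[[l r] [/= lr_open]]; rewrite itv_boundlr => /andP[lx xr] lrU.
  have {}lrU y : (l <= BLeft y)%O -> (BRight y <= r)%O -> U y.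
    by move=> ly yr; apply: lrU; rewrite /= itv_boundlr ly.
  split=> a ax.
  - case: l lr_open lx lrU => [[]l|[]]//=.
    + move=> _ lx lrU; exists l => // y ly yx; apply: lrU => //.
      by apply: le_trans xr; rewrite bnd_simp.
    + move=> _ _ lrU; exists a => // y _ yx; apply: lrU => //.
      by apply: le_trans xr; rewrite bnd_simp.
  - case: r lr_open xr lrU => [[]r|[]]//=.
    + move=> _ xr lrU; exists r => // y xy yr; apply: lrU => //.
      by apply: le_trans lx _; rewrite bnd_simp.
    + by case: l {lx} => [[]?|[]].
    + move=> _ _ lrU; exists a => // y xy _; apply: lrU => //.
      by apply: le_trans lx _; rewrite bnd_simp.
rewrite openE => x Ux; have [Ul Ur] := UP x Ux.
rewrite /interior itv_nbhsE.
have [l [lx lU lo]] : exists l : itv_bound T, [/\ (l <= BLeft x)%O,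
    (forall y, (l <= BLeft y)%O -> y <= x -> U y) &
    (l = -oo%O \/ exists b, l = BRight b)].
  have [[a /Ul[b bx bU]]|noa] := pselect (exists a, a < x).
    by exists (BRight b); split=> //; right; exists b.
  exists (-oo%O); split=> //; last by left.
  move=> y _ yx; suff -> : y = x by [].
  by apply/eqP; rewrite eq_le yx /= leNgt; apply/negP => ?; apply: noa; exists y.
have [r [xr rU ro]] : exists r : itv_bound T, [/\ (BRight x <= r)%O,
    (forall y, x <= y -> (BRight y <= r)%O -> U y) &
    (r = +oo%O \/ exists b, r = BLeft b)].
  have [[a /Ur[b bx bU]]|noa] := pselect (exists a, x < a).
    by exists (BLeft b); split=> //; right; exists b.
  exists (+oo%O); split=> //; last by left.
  move=> y yx _; suff -> : y = x by [].
  by apply/eqP; rewrite eq_le yx andbT leNgt; apply/negP => ?; apply: noa; exists y.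
exists (Interval l r); first split.
- by case: lo => [->|[b ->]]; case: ro => [->|[b' ->]].
- by rewrite itv_boundlr lx.
- move=> y /=; rewrite itv_boundlr => /andP[ly yr].
  by have [yx|/ltW xy] := leP y x; [exact: lU|exact: rU].
Qed.

End one_sided_neighbourhoods.

Section connected_intervals.
Context d (T : orderType d).
Hypotheses (Tdense : densely_ordered T) (Tcomplete : order_complete T).

(** The supremum [s] of the [w] with [x, w] inside [U] lies neither in [V], which
    would contain points of [U] to the left of [s], nor, if [s < z], in [U],
    which would then extend to the right of [s]. *)
Lemma itv_not_separated (U V : set (order_topology T)) (x z : T) :
  open U -> open V -> x <= z -> U x ->
  (forall y, x <= y <= z -> U y \/ V y) ->
  (forall y, x <= y <= z -> U y -> ~ V y) -> U z.
Proof.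
move=> /order_openP Uo /order_openP Vo xz Ux cov dis.
pose E : set T := [set w | x <= w <= z /\ forall y, x <= y <= w -> U y].
have Ex : E x.
  split=> [|y]; first by rewrite lexx.
  by move=> xyx; have <- : x = y by apply: le_anti.
have [s [sub slub]] := Tcomplete E.
have xs : x <= s by exact: sub.
have sz : s <= z by apply: slub => w [/andP[]].
have below y : x <= y < s -> U y.
  move=> /andP[xy ys]; apply: contrapT => nUy.
  suff : s <= y by rewrite leNgt ys.
  apply: slub => w [_ wU]; rewrite leNgt; apply/negP => yw.
  by apply: nUy; apply: wU; rewrite xy ltW.
have Us : U s.
  have [//|Vs] : U s \/ V s by apply: cov; rewrite xs.
  have [<-//|nxs] := eqVneq x s.
  have {}xs : x < s by rewrite lt_neqAle nxs.
  have [b bs bV] := (Vo s Vs).1 _ xs.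
  have [c /andP[c1 cs]] : exists c, Order.max b x < c < s.
    by apply: Tdense; rewrite gt_max bs.
  have bc : b < c by apply: le_lt_trans c1; rewrite le_max lexx.
  have xc : x < c by apply: le_lt_trans c1; rewrite le_max lexx orbT.
  case: (dis c _ (below c _) (bV c bc (ltW cs))).
    by rewrite (ltW xc) /= (le_trans (ltW cs)).
  by rewrite (ltW xc).
have [<-//|nsz] := eqVneq s z.
have {}sz : s < z by rewrite lt_neqAle nsz.
have [b sb bU] := (Uo s Us).2 _ sz.
have [c /andP[sc c1]] : exists c, s < c < Order.min b z.
  by apply: Tdense; rewrite lt_min sb.
suff : c <= s by rewrite leNgt sc.
have cb : c < b by apply: lt_le_trans c1 _; rewrite ge_min lexx.
apply: sub; split=> [|y /andP[xy yc]].
  rewrite (ltW (le_lt_trans xs sc)) /=.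
  by apply: ltW; apply: lt_le_trans c1 _; rewrite ge_min lexx orbT.
have [sy|ys] := leP s y; last by apply: below; rewrite xy.
by apply: bU => //; exact: le_lt_trans cb.
Qed.

Lemma connected_segment (x z : T) :
  connected ([set y | x <= y <= z] : set (order_topology T)).
Proof.
set A : set (order_topology T) := (X in connected X).
move=> B [b0 B0] [C Co BC] [D Dc BD].
have CD y : A y -> C y <-> D y.
  move=> Ay; split=> Xy.
    by have By : B y by [rewrite BC]; move: By; rewrite BD => -[].
  by have By : B y by [rewrite BD]; move: By; rewrite BC => -[].
have nDo : open (~` D) by rewrite openC.
have Ab0 : A b0 by move: B0; rewrite BC => -[].
have AW y w : A y -> x <= w <= y -> A w.
  by move=> /andP[_ yz] /andP[xw wy]; rewrite /A /= xw (le_trans wy).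
have [Cx|nCx] := pselect (C x).
  rewrite BC; apply/setIidPl => y Ay.
  have /andP[xy yz] : x <= y <= z := Ay.
  apply: (itv_not_separated Co nDo xy Cx) => w /(AW _ _ Ay) /CD Aw.
    by rewrite Aw /=; exact: EM.
  by rewrite Aw => ? /=; exact.
exfalso.
have /andP[xb bz] : x <= b0 <= z := Ab0.
have Ax : A x by apply: (AW _ _ Ab0); rewrite lexx.
suff : (~` D) b0 by apply; move: B0; rewrite BD => -[].
apply: (itv_not_separated nDo Co xb _) => [|w /(AW _ _ Ab0)|w /(AW _ _ Ab0)] /=.
- by rewrite -CD.
- by move=> /CD ->; rewrite orC; exact: EM.
- by move=> /CD ->.
Qed.

End connected_intervals.

(** * The circles *)

Section minus_last.
Context d (L : tOrderType d).

Lemma minus_last_lt (x : minus_last L) : val x < \top.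
Proof. by rewrite lt_neqAle (valP x) lex1. Qed.

Lemma minus_lastP (y : L) : y != \top -> exists y' : minus_last L, y = val y'.
Proof. by move=> yt; exists (exist _ y yt). Qed.

Lemma minus_last_below (y b : L) : y < b -> exists y' : minus_last L, y = val y'.
Proof. by move=> yb; apply: minus_lastP; rewrite lt_eqF // (lt_le_trans yb) // lex1. Qed.

End minus_last.

Section circle.
Context d (L : tOrderType d) (b0 : minus_last L).
Hypothesis b0_min : forall x : L, val b0 <= x.
Context (n : nat).
Hypothesis n_gt0 : (0 < n)%N.
Local Notation M := (minus_last L).
Implicit Types (i j : 'I_n) (x y : M) (u v w : copies L n).

Definition ord_first : 'I_n := Ordinal n_gt0.

Lemma copies_ltE i j x y : ((Some (i, x) : copies L n) < (Some (j, y) : copies L n)) =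
  (i < j)%N || ((i == j) && (val x < val y)).
Proof.
rewrite ltNge copies_leE -ltEsub -val_eqE /=.
by case: (ltngtP i j) => //= _; rewrite ltNge.
Qed.

Lemma endpointsP u :
  endpoints u <-> u = None \/ u = Some (ord_first, b0).
Proof.
split=> [[umin|umax]|[->|->]].
- right; apply: le_anti; rewrite umin /=.
  case: u {umin} => [[i x]|] //.
  by rewrite copies_leE leq0n leEsub /= b0_min implybT.
- by left; apply: le_anti; rewrite umax; case: u {umax}.
- by right; case.
- by left=> -[[j y]|] //; rewrite copies_leE leq0n leEsub b0_min implybT.
Qed.

Lemma to_collapse_eq u v : (to_collapse (@endpoints _ L n) u = to_collapse (@endpoints _ L n) v) <->
  (u = v \/ endpoints u /\ endpoints v).
Proof.
split=> [/eqmodP/predU1P[->|/andP[]]|uv]; first by left.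
  by rewrite !inE => ? ?; right.
apply/eqmodP/predU1P; case: uv => [->|[? ?]]; first by left.
by right; rewrite !mem_set.
Qed.

(** [None], which has no coordinates of its own, is identified with the first
    point of the first copy. *)
Definition coord (s : Sigma L n) : 'I_n * M :=
  if of_collapse s is Some ix then ix else (ord_first, b0).

Lemma circle_pt_inj i j x y : circle_pt i x = circle_pt j y -> (i, x) = (j, y).
Proof.
move=> /to_collapse_eq[[-> ->]//|[]] /endpointsP[//|[-> ->]].
by move=> /endpointsP[//|[-> ->]].
Qed.

Lemma coordK (s : Sigma L n) : circle_pt (coord s).1 (coord s).2 = s.
Proof.
rewrite /coord; set u := of_collapse s.
have <- : to_collapse (@endpoints _ L n) u = s by exact: reprK.
case: u => [[i x]//|]; apply/to_collapse_eq; right.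
by split; apply/endpointsP; [right|left].
Qed.

Lemma circle_ptK i x : coord (circle_pt i x) = (i, x).
Proof.
have := coordK (circle_pt i x).
by case: (coord _) => j y /= /circle_pt_inj.
Qed.

(** The [i]-th copy of [L] inside the line of copies, including its last point:
    that point is the first point of the next copy, except in the last copy. *)
Definition copies_arc i (x : L) : copies L n :=
  if insub x is Some y then Some (i, y)
  else if insub i.+1 is Some j then Some (j, b0) else None.

Definition circle_arc i (x : L) : Sigma L n :=
  if insub x is Some y then circle_pt i y else circle_pt (ordS i) b0.

Lemma arcE i x : circle_arc i (val x) = circle_pt i x.
Proof. by rewrite /circle_arc valK. Qed.

Lemma arc_top i : circle_arc i \top = circle_pt (ordS i) b0.
Proof. by rewrite /circle_arc insubF ?eqxx. Qed.

Lemma to_collapse_arc i (x : L) : to_collapse (@endpoints _ L n) (copies_arc i x) = circle_arc i x.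
Proof.
rewrite /copies_arc /circle_arc; case: insubP => // _.
case: insubP => [j jn ji|nj]; apply/to_collapse_eq.
  left; congr (Some (_, _)); apply: val_inj => /=.
  by rewrite modn_small // ltn_ord.
right; split; apply/endpointsP; [by left|right].
congr (Some (_, _)); apply: val_inj => /=.
have -> : i.+1 = n by apply/eqP; rewrite eqn_leq ltn_ord leqNgt.
by rewrite modnn.
Qed.

Lemma copies_arcP i (x : L) :
  [\/ exists2 y, x = val y & copies_arc i x = Some (i, y),
   [/\ x = \top, i.+1 = n & copies_arc i x = None] |
   exists2 j, x = \top /\ val j = i.+1 & copies_arc i x = Some (j, b0)].
Proof.
rewrite /copies_arc; case: insubP => [y _ <-|/negPn/eqP ->]; first by constructor 1; exists y.
case: insubP => [j _ ji|ni]; first by constructor 3; exists j.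
by constructor 2; split=> //; apply/eqP; rewrite eqn_leq ltn_ord leqNgt.
Qed.

Lemma copies_arc_lt i (x y : L) : (copies_arc i x < copies_arc i y) = (x < y).
Proof.
have mono (a b : L) : a < b -> copies_arc i a < copies_arc i b.
  case: (copies_arcP i b) => [[y' -> ->]|[-> _ ->]|[j [-> ji] ->]];
  case: (copies_arcP i a) => [[x' -> ->]|[-> _ ->]|[k [-> ki] ->]] //;
  rewrite ?ltxx ?copies_ltE ?eqxx ?ltnn //= ?lt1x // ?ji ?ltnSn //.
have [xy|yx|->] := ltgtP x y; first exact: mono.
  by apply/negbTE; rewrite -leNgt ltW // mono.
by rewrite ltxx.
Qed.

Lemma copies_arc_le i (x y : L) : (copies_arc i x <= copies_arc i y) = (x <= y).
Proof. by rewrite !leNgt copies_arc_lt. Qed.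

Lemma copies_arc_convex i (a b : L) u :
  copies_arc i a <= u -> u <= copies_arc i b -> exists z, u = copies_arc i z.
Proof.
case: u => [[j y]|] au ub; last first.
  by exists b; apply/esym/le_anti; rewrite ub andbT; case: copies_arc.
have ij : (i <= j)%N.
  case: (copies_arcP i a) au => [[a' _ ->]|[_ _ ->]|[k [_ ki] ->]] //.
    by rewrite copies_leE => /andP[].
  by rewrite copies_leE ki => /andP[/ltnW].
have [ji|ltij] := leqP j i.
  exists (val y); rewrite /copies_arc valK; congr (Some (_, _)).
  by apply/val_inj/anti_leq; rewrite ij ji.
exists b; case: (copies_arcP i b) ub => [[b' _ ->]|[_ i_last ->]|[k [_ ki] ->]].
- by rewrite copies_leE leqNgt ltij.
- by have := ltn_ord j; lia.
- rewrite copies_leE ki ltij /= andbC => /andP[yb jk].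
  congr (Some (_, _)); first by apply/val_inj/anti_leq; rewrite ki jk ltij.
  by apply/val_inj/le_anti; rewrite b0_min andbT -leEsub.
Qed.

(** On each side, a small one-sided neighbourhood lies in a single copy of [L];
    for the first point of a copy, the left one lies in the previous copy. *)
Lemma copies_left u : (forall v, u <= v) \/ exists i (x : L), u = copies_arc i x /\ val b0 < x.
Proof.
have top_gt : val b0 < \top by exact: minus_last_lt.
case: u => [[i y]|].
  have [->|yb] := eqVneq y b0; last first.
    right; exists i, (val y); rewrite /copies_arc valK; split=> //.
    by rewrite lt_neqAle b0_min andbT eq_sym.
  case: i => -[|i] iP.
    by left=> -[[j y']|] //; rewrite copies_leE leq0n leEsub b0_min implybT.
  right; exists (Ordinal (ltnW iP)), \top; split=> //.
  rewrite /copies_arc insubF ?eqxx //=.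
  by case: insubP => [j _ jE|/negP//]; congr (Some (_, _)); exact: val_inj.
right; have nP : (n.-1 < n)%N by rewrite prednK.
exists (Ordinal nP), \top; split=> //.
by rewrite /copies_arc insubF ?eqxx //= prednK // insubF ?ltnn.
Qed.

Lemma copies_right u : (forall v, v <= u) \/ exists i (x : L), u = copies_arc i x /\ x < \top.
Proof.
case: u => [[i y]|]; last by left=> v; case: v.
by right; exists i, (val y); rewrite /copies_arc valK minus_last_lt.
Qed.

(** The circle is obtained by gluing [n] copies of [L] along their end points.
    All continuity statements about circles reduce to [L] by this lemma. *)
Lemma open_SigmaP (U : set (Sigma L n)) :
  open U <-> forall i, open (circle_arc i @^-1` U : set (order_topology L)).
Proof.
pose V : set (copies L n) := to_collapse (@endpoints _ L n) @^-1` U.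
have VU i (x : L) : V (copies_arc i x) <-> U (circle_arc i x) by rewrite -to_collapse_arc.
have UV : open U <-> open V by [].
rewrite UV; split=> [/order_openP Vo i|Uo]; apply/order_openP.
  move=> x /VU Vx; split=> a ax.
    have [|b bx bV] := (Vo _ Vx).1 (copies_arc i a); first by rewrite copies_arc_lt.
    have [ba|ab] := leP b (copies_arc i a).
      exists a => // y ay yx; apply/VU; apply: bV; rewrite ?copies_arc_le //.
      by apply: le_lt_trans ba _; rewrite copies_arc_lt.
    have [a' ba'] := copies_arc_convex (ltW ab) (ltW bx); subst b.
    exists a' => [|y ay yx]; first by rewrite -(copies_arc_lt i).
    by apply/VU; apply: bV; rewrite ?copies_arc_le ?copies_arc_lt.
  have [|b bx bV] := (Vo _ Vx).2 (copies_arc i a); first by rewrite copies_arc_lt.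
  have [ba|ab] := leP (copies_arc i a) b.
    exists a => // y ay yx; apply/VU; apply: bV; rewrite ?copies_arc_le //.
    by apply: lt_le_trans ba; rewrite copies_arc_lt.
  have [a' ba'] := copies_arc_convex (ltW bx) (ltW ab); subst b.
  exists a' => [|y ay yx]; first by rewrite -(copies_arc_lt i).
  by apply/VU; apply: bV; rewrite ?copies_arc_le ?copies_arc_lt.
move=> u Vu; split=> a au.
  have [umin|[i [x [ux bx]]]] := copies_left u.
    by have := umin a; rewrite leNgt au.
  subst u; have /order_openP/(_ x) := Uo i.
  rewrite /= -VU => /(_ Vu)[/(_ _ bx)[b xb bU] _].
  exists (copies_arc i b) => [|v bv vx]; first by rewrite copies_arc_lt.
  have [w vw] := copies_arc_convex (ltW bv) vx; subst v.
  by apply/VU; apply: bU; rewrite -?(copies_arc_lt i) -?(copies_arc_le i).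
have [umax|[i [x [ux xt]]]] := copies_right u.
  by have := umax a; rewrite leNgt au.
subst u; have /order_openP/(_ x) := Uo i.
rewrite /= -VU => /(_ Vu)[_ /(_ _ xt)[b xb bU]].
exists (copies_arc i b) => [|v xv vb]; first by rewrite copies_arc_lt.
have [w vw] := copies_arc_convex xv (ltW vb); subst v.
by apply/VU; apply: bU; rewrite -?(copies_arc_lt i) -?(copies_arc_le i).
Qed.

End circle.

(** * The solenoid and its homeomorphisms *)

Section order_automorphisms.
Context d (L : tOrderType d).

Definition order_aut (F G : L -> L) :=
  [/\ cancel F G, cancel G F & {homo F : x y / x < y}].

Lemma order_aut_lt (F G : L -> L) : order_aut F G -> {mono F : x y / x < y}.
Proof.
move=> [FK GK Fh] x y; have [xy|yx|->] := ltgtP x y; last by rewrite ltxx.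
  by rewrite Fh.
by apply/negbTE; rewrite -leNgt ltW // Fh.
Qed.

Lemma order_aut_sym (F G : L -> L) : order_aut F G -> order_aut G F.
Proof.
move=> FG; have [FK GK _] := FG; split=> // x y xy.
by rewrite -(order_aut_lt FG) !GK.
Qed.

Lemma order_aut_min (F G : L -> L) b :
  order_aut F G -> (forall x, b <= x) -> F b = b.
Proof.
move=> FG bmin; have [FK GK _] := FG; apply/le_anti; rewrite bmin andbT.
by rewrite leNgt -{1}(GK b) (order_aut_lt FG) -leNgt.
Qed.

Lemma order_aut_top (F G : L -> L) : order_aut F G -> F \top = \top.
Proof.
move=> FG; have [FK GK _] := FG; apply/le_anti; rewrite lex1 /=.
by rewrite leNgt -{2}(GK \top) (order_aut_lt FG) -leNgt lex1.
Qed.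

Lemma order_aut_open (F G : L -> L) (U : set (order_topology L)) : order_aut F G ->
  open U -> open (F @^-1` U : set (order_topology L)).
Proof.
move=> FG /order_openP Uo; have [FK GK Fh] := FG.
apply/order_openP => x /Uo [Ul Ur]; split=> a ax.
  have [b bx bU] := Ul _ (Fh _ _ ax).
  exists (G b) => [|y by_ yx]; first by rewrite -(order_aut_lt FG) GK.
  apply: bU; first by rewrite -(GK b) (order_aut_lt FG).
  by rewrite leNgt (order_aut_lt FG) -leNgt.
have [b bx bU] := Ur _ (Fh _ _ ax).
exists (G b) => [|y xy yb]; first by rewrite -(order_aut_lt FG) GK.
apply: bU; last by rewrite -(GK b) (order_aut_lt FG).
by rewrite leNgt (order_aut_lt FG) -leNgt.
Qed.

Fact minus_last_map_subproof (F G : L -> L) (FG : order_aut F G) (x : minus_last L) :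
  F (val x) != \top.
Proof.
have [FK _ _] := FG; have xt := valP x; apply/eqP => Ft.
have xE : val x = \top by rewrite -(FK (val x)) Ft -{1}(order_aut_top FG) FK.
by move: xt; rewrite /= xE eqxx.
Qed.

Definition minus_last_map F G (FG : order_aut F G) (x : minus_last L) : minus_last L :=
  exist (fun x : L => x != \top) _ (minus_last_map_subproof FG x).

End order_automorphisms.

Section rotation.
Context (n : nat).

Fact rot_subproof k (i : 'I_n) : ((i + k) %% n < n)%N.
Proof. by rewrite ltn_mod (leq_ltn_trans _ (ltn_ord i)). Qed.

Definition rot k (i : 'I_n) : 'I_n := Ordinal (rot_subproof k i).

Lemma rot_ordS k (i : 'I_n) : rot k (ordS i) = ordS (rot k i).
Proof. by apply: val_inj; rewrite /= modnDml -[in RHS]addn1 modnDml addn1. Qed.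

Lemma rotK k l : (k + l = 0 %[mod n])%N -> cancel (rot k) (rot l).
Proof.
move=> kl i; apply: val_inj; rewrite /= modnDml -addnA -modnDmr kl.
by rewrite mod0n addn0 modn_small // ltn_ord.
Qed.

End rotation.

Lemma cover_ord_rot m n k l (i : 'I_(m * n)) : (k = l %[mod n])%N ->
  cover_ord (rot k i) = rot l (cover_ord i).
Proof.
move=> kl; apply: val_inj; rewrite /= modn_dvdm ?dvdn_mull //.
by rewrite modnDml -modnDmr kl modnDmr.
Qed.

Lemma cover_ord_ordS m n (i : 'I_(m * n)) : cover_ord (ordS i) = ordS (cover_ord i).
Proof.
apply: val_inj; rewrite /= modn_dvdm ?dvdn_mull //.
by rewrite -addn1 -(modnDml i) addn1.
Qed.

Section solenoid.
Context d (L : tOrderType d) (b0 : minus_last L) (p : nat -> nat).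
Hypothesis b0_min : forall x : L, val b0 <= x.
Hypothesis p_gt0 : forall n, (0 < p n)%N.
Local Notation M := (minus_last L).
Local Notation S := (solenoid L p).
Local Notation w := (winding p).

Lemma winding_gt0 n : (0 < w n)%N.
Proof. by elim: n => //= n IHn; rewrite muln_gt0 p_gt0. Qed.
Local Notation w_gt0 := winding_gt0.

Local Notation arc := (circle_arc b0).

Lemma cover_arc m n (i : 'I_(m * n)) (x : L) :
  cover (arc i x) = arc (cover_ord i) x.
Proof.
rewrite /circle_arc; case: insubP => [y _ _|_]; rewrite cover_circle_pt //.
by rewrite cover_ord_ordS.
Qed.

Section turn_circle.
Context (n : nat) (n_gt0 : (0 < n)%N).

Definition turn_circle k (F : L -> L) (s : Sigma L n) : Sigma L n :=
  arc (rot k (coord b0 n_gt0 s).1) (F (val (coord b0 n_gt0 s).2)).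

Lemma turn_circle_arc k F G i x : order_aut F G ->
  turn_circle k F (arc i x) = arc (rot k i) (F x).
Proof.
move=> FG; have [xt|/negPn/eqP ->] := boolP (x != \top).
  have [y ->] := minus_lastP xt.
  by rewrite arcE /turn_circle circle_ptK.
rewrite arc_top /turn_circle circle_ptK //= (order_aut_min FG b0_min).
by rewrite (order_aut_top FG) arc_top arcE rot_ordS.
Qed.

Lemma turn_circle_continuous k F G :
  order_aut F G -> continuous (turn_circle k F).
Proof.
move=> FG; apply/continuousP => U /(open_SigmaP b0_min n_gt0) Uo.
apply/(open_SigmaP b0_min n_gt0) => i.
have -> : arc i @^-1` (turn_circle k F @^-1` U) = F @^-1` (arc (rot k i) @^-1` U).
  by apply/funext => x; rewrite /preimage /= (turn_circle_arc _ _ _ FG).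
exact: (order_aut_open FG (Uo _)).
Qed.

End turn_circle.

(** These sequences form the inverse limit of the cyclic groups Z/k(n). *)
Definition digits_compatible (g : forall n, 'I_(w n)) :=
  forall n, cover_ord (g n.+1 : 'I_(p n * w n)) = g n.

Definition digits (s : S) n : 'I_(w n) := (coord b0 (w_gt0 n) (val s n)).1.
Definition position (s : S) : M := (coord b0 (w_gt0 0) (val s 0)).2.

Lemma cover_val (s : S) n : cover (val s n.+1 : Sigma L (p n * w n)) = val s n.
Proof. exact: (set_mem (valP s)). Qed.

Lemma coord_cover (s : S) n :
  coord b0 (w_gt0 n) (val s n) =
  (cover_ord (digits s n.+1 : 'I_(p n * w n)), (coord b0 (w_gt0 n.+1) (val s n.+1)).2).
Proof.
rewrite -cover_val -[X in cover X](coordK b0_min (w_gt0 n.+1)) cover_circle_pt.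
by rewrite circle_ptK.
Qed.

Lemma digitsP s : digits_compatible (digits s).
Proof. by move=> n; rewrite [RHS]/digits coord_cover. Qed.

Lemma positionE s n : (coord b0 (w_gt0 n) (val s n)).2 = position s.
Proof. by elim: n => // n <-; rewrite [in RHS]coord_cover. Qed.

Lemma val_solenoid s n : val s n = circle_pt (digits s n) (position s).
Proof. by rewrite -(positionE s n) coordK. Qed.

Lemma continuous_proj n : continuous (fun s : S => val s n : Sigma L (w n)).
Proof.
move=> s; apply: (@continuous_comp _ _ _ (val : S -> prod_topology (fun n => Sigma L (w n))) (fun u => u n)).
  exact: initial_continuous.
exact: (@proj_continuous _ (fun n => Sigma L (w n)) n).
Qed.

Lemma continuous_solenoid (Z : topologicalType) (f : Z -> S) :
  (forall n, continuous (fun z => val (f z) n : Sigma L (w n))) -> continuous f.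
Proof.
move=> fc; apply: continuous_comp_initial => z.
apply/cvg_sup => n.
apply: (@continuous_comp_initial _ _ _ (fun u : prod_topology (fun n => Sigma L (w n)) => u n)).
exact: fc.
Qed.

Fact thread_subproof g (gP : digits_compatible g) (x : L) :
  (fun n => arc (g n) x : Sigma L (w n)) \in @solenoid_set _ L p.
Proof. by apply/mem_set => n; rewrite cover_arc gP. Qed.

(** A lift of [L] to the solenoid.  Its last point is on the next thread, where
    it is the first point: all digits have increased by one. *)
Definition thread g (gP : digits_compatible g) (x : L) : S :=
  exist (fun u => u \in @solenoid_set _ L p) _ (thread_subproof gP x).

Lemma solenoid_eq (s t : S) : digits s = digits t -> position s = position t -> s = t.
Proof.
move=> st1 st2; apply: val_inj; apply: functional_extensionality_dep => n.
by rewrite !val_solenoid st1 st2.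
Qed.

Section thread.
Context g (gP : digits_compatible g).

Lemma digits_thread (x : M) : digits (thread gP (val x)) = g.
Proof.
apply: functional_extensionality_dep => n.
by rewrite /digits /= arcE circle_ptK.
Qed.

Lemma position_thread (x : M) : position (thread gP (val x)) = x.
Proof. by rewrite /position /= arcE circle_ptK. Qed.

Lemma position_thread_top : position (thread gP \top) = b0.
Proof. by rewrite /position /= arc_top circle_ptK. Qed.

Lemma thread_continuous : continuous (thread gP : order_topology L -> S).
Proof.
apply: continuous_solenoid => n; apply/continuousP => U.
by move=> /(open_SigmaP b0_min (w_gt0 n)); apply.
Qed.

Lemma connected_thread (x y : L) : densely_ordered L -> order_complete L ->
  connected (thread gP @` [set z | x <= z <= y]).
Proof.
move=> Ld Lc; apply: (@connected_continuous_connected (order_topology L)).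
  exact: connected_segment.
exact/continuous_subspaceT/thread_continuous.
Qed.

End thread.

Lemma threadK s : thread (digitsP s) (val (position s)) = s.
Proof. by apply: solenoid_eq; rewrite ?digits_thread ?position_thread. Qed.

Section turn.
Context (h : nat -> nat) (F G : L -> L).
Hypothesis hP : forall n, (h n.+1 = h n %[mod w n])%N.
Hypothesis FG : order_aut F G.

Fact turn_subproof (s : S) :
  (fun n => arc (rot (h n) (digits s n)) (F (val (position s))) : Sigma L (w n))
    \in @solenoid_set _ L p.
Proof.
apply/mem_set => n; rewrite cover_arc (cover_ord_rot _ (hP n)).
by rewrite (digitsP s n).
Qed.

Definition turn (s : S) : S := exist (fun u => u \in @solenoid_set _ L p) _ (turn_subproof s).

Lemma turn_continuous : continuous turn.
Proof.
apply: continuous_solenoid => n s.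
have -> : (fun s => val (turn s) n) =
    turn_circle (w_gt0 n) (h n) F \o (fun s : S => val s n : Sigma L (w n)).
  by apply: funext => t /=; rewrite /turn_circle positionE.
apply: (@continuous_comp _ _ _ (fun s : S => val s n : Sigma L (w n))
    (turn_circle (w_gt0 n) (h n) F)); first exact: continuous_proj.
exact: (turn_circle_continuous FG).
Qed.

Lemma digits_turn s n : digits (turn s) n = rot (h n) (digits s n).
Proof.
by rewrite /digits /= -[F _]/(val (minus_last_map FG _)) arcE circle_ptK.
Qed.

Lemma position_turn s : val (position (turn s)) = F (val (position s)).
Proof.
by rewrite {1}/position /= -[F _]/(val (minus_last_map FG _)) arcE circle_ptK.
Qed.

End turn.

Lemma turn_cancel h k F G (hP : forall n, (h n.+1 = h n %[mod w n])%N)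
    (kP : forall n, (k n.+1 = k n %[mod w n])%N) (FG : order_aut F G) (GF : order_aut G F) :
  (forall n, h n + k n = 0 %[mod w n])%N -> cancel (turn F hP) (turn G kP).
Proof.
move=> hk s; apply: solenoid_eq.
  apply: functional_extensionality_dep => n.
  by rewrite (digits_turn _ GF) (digits_turn _ FG) rotK.
by apply: val_inj; rewrite (position_turn _ GF) (position_turn _ FG); case: FG => ->.
Qed.

(** The rotation amounts [g' n - g n] are compatible with the bonding maps and
    translate the index sequence [g] to [g']. *)
Lemma thread_homeo g g' (gP : digits_compatible g) (gP' : digits_compatible g') F G (x : M) :
  order_aut F G ->
  exists2 f, Homeo S f & f (thread gP (val x)) = thread gP' (F (val x)).
Proof.
move=> FG.
(* The difference [b n - a n], made nonnegative by adding a full turn. *)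
pose h (a b : forall n, 'I_(w n)) n := (b n + (w n - a n))%N.
have hP a b : digits_compatible a -> digits_compatible b ->
    forall n, (h a b n.+1 = h a b n %[mod w n])%N.
  move=> aP bP n; have := aP n; have := bP n.
  move=> /(congr1 val) /= bE /(congr1 val) /= aE.
  apply/eqP; rewrite -(eqn_modDr (a n.+1)) /h -addnA subnK; last exact: ltnW.
  rewrite -[w n.+1]/(p n * w n)%N (addnC (b n.+1 : nat)) modnMDl.
  rewrite -[in X in _ == X]modnDmr aE -addnA subnK; last exact: ltnW.
  by rewrite modnDr bE modn_small.
have hh a b n : (h a b n + h b a n = 0 %[mod w n])%N.
  have -> : (h a b n + h b a n = 2 * w n)%N.
    by have := ltn_ord (a n); have := ltn_ord (b n); rewrite /h; lia.
  by rewrite modnMl mod0n.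
exists (turn F (hP _ _ gP gP')).
  have GF := order_aut_sym FG.
  exists (turn G (hP _ _ gP' gP)); split.
  - exact: (turn_cancel _ _ FG GF).
  - exact: (turn_cancel _ _ GF FG).
  - exact: (turn_continuous FG).
  - exact: (turn_continuous GF).
apply: solenoid_eq.
  apply: functional_extensionality_dep => n; rewrite (digits_turn _ FG) digits_thread.
  rewrite -[F _]/(val (minus_last_map FG x)) digits_thread; apply: val_inj => /=.
  by rewrite addnCA subnKC ?modnDr ?modn_small // ltnW.
apply: val_inj; rewrite (position_turn _ FG) position_thread.
by rewrite -[F _]/(val (minus_last_map FG x)) position_thread.
Qed.

End solenoid.

(** * Orbits of the solenoid of a ranked continuum *)

Section homeo_groups.
Context (Y : topologicalType).
Implicit Types (f g : Y -> Y) (x y : Y).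

Lemma Homeo_id : Homeo Y id.
Proof. by exists id; split=> // x; exact: cvg_id. Qed.

Lemma Homeo_comp f g : Homeo Y f -> Homeo Y g -> Homeo Y (f \o g).
Proof.
move=> [f' [fK f'K fc f'c]] [g' [gK g'K gc g'c]]; exists (g' \o f'); split.
- exact: can_comp.
- exact: can_comp.
- by move=> x; apply: continuous_comp; [exact: gc|exact: fc].
- by move=> x; apply: continuous_comp; [exact: f'c|exact: g'c].
Qed.

Lemma Homeo_inv f : Homeo Y f -> exists2 f', Homeo Y f' & cancel f f'.
Proof. by move=> [f' [fK f'K fc f'c]]; exists f' => //; exists f. Qed.

Lemma homeo_orbit_eq f x : Homeo Y f -> homeo_orbit (f x) = homeo_orbit x.
Proof.
move=> fH; have [f' f'H fK] := Homeo_inv fH.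
apply/seteqP; split=> _ [g gH <-].
  by exists (g \o f) => //; exact: Homeo_comp.
exists (g \o f'); first exact: Homeo_comp.
by rewrite /= fK.
Qed.

(** Inside a small open set, connected sets stay on one thread; restricting the
    limit to them ignores the points of nearby threads, which accumulate
    everywhere. *)
Definition continuum_limit (P : Y -> Prop) x :=
  forall U : set Y, open U -> U x ->
  exists C : set Y, [/\ connected C, C `<=` U, C x & exists2 z, C z & z <> x /\ P z].

Definition wild k : Y -> Prop :=
  iter k continuum_limit (fun x => ~ Gdelta [set x]).

Lemma wild_Homeo k f x : Homeo Y f -> wild k x -> wild k (f x).
Proof.
move=> fH; have [f' [fK f'K fc _]] := fH.
elim: k x => [|k IHk] x /=.
  apply: contra_not => -[F Fo FE]; exists (fun i => f @^-1` F i).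
    by move=> i; apply: open_comp => // y _; exact: fc.
  rewrite -preimage_bigcap -FE; apply/seteqP; split=> y /=; first by move=> ->.
  exact: can_inj.
move=> xlim U Uo Ufx.
have [|//|C [Cc CU Cx [z Cz [zx zk]]]] := xlim (f @^-1` U).
  by apply: open_comp => // y _; exact: fc.
exists (f @` C); split.
- apply: connected_continuous_connected => //; exact/continuous_subspaceT.
- by move=> _ [y Cy <-]; exact: CU.
- by exists x.
- exists (f z); first by exists z.
  by split; [move=> /(can_inj fK)|exact: IHk].
Qed.

End homeo_groups.

(** The properties of a continuum [L] used to compute the orbits of its solenoid;
    [r] is the rank and [K] its value at the first point.  A point of rank 0 has
    countable cofinality on both sides; a point of rank 1 has uncountable
    cofinality on the left.  If the first point of [L] has rank 1, what lies to
    its left in a circle is the end of the preceding copy of [L], so the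
    cofinality is that of the last point of [L]. *)
Record ranked d (L : tOrderType d) (b0 : minus_last L) (r : L -> nat) (K : nat)
    : Prop := Ranked {
  ranked_min : forall x : L, val b0 <= x;
  ranked_dense : densely_ordered L;
  ranked_complete : order_complete L;
  ranked_gt0 : (0 < K)%N;
  ranked_first : r (val b0) = K;
  ranked_lt : forall x, x != \top -> x != val b0 -> (r x < K)%N;
  ranked_separated : forall x, x != \top -> r x = 0 ->
    exists e : nat -> L, (forall y, y < x -> exists n, y <= e n < x) /\
                         (forall y, x < y -> exists n, x < e n <= y);
  ranked_cofinal : forall x, x != \top -> r x = 1 ->
    let z := if x == val b0 then \top else x in
    forall e : nat -> L, (forall n, e n < z) -> exists2 c, c < z & forall n, e n <= c;
  ranked_right : forall x, x != \top -> (1 < r x)%N ->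
    forall b, x < b -> exists2 y, x < y < b & r y = (r x).-1;
  ranked_near : forall x, x != \top -> x != val b0 ->
    exists a b, a < x < b /\
      forall y, a < y < b -> y != x -> (r y < r x)%N \/ r y = 0;
  ranked_aut : forall x y, x != \top -> y != \top -> r x = r y ->
    exists F G, order_aut F G /\ F x = y }.

Section orbits.
Context d (L : tOrderType d) (b0 : minus_last L) (r : L -> nat) (K : nat).
Context (p : nat -> nat).
Hypothesis rP : ranked b0 r K.
Hypothesis p_gt0 : forall n, (0 < p n)%N.
Local Notation M := (minus_last L).
Local Notation S := (solenoid L p).
Local Notation w := (winding p).
Local Notation b0_min := (ranked_min rP).
Local Notation digits_compatible := (@digits_compatible p).
Local Notation digits := (digits b0 p_gt0).
Local Notation position := (position b0 p_gt0).

(** The preimage of an open interval of the [n]-th circle. *)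
Let tube n (i : 'I_(w n)) (a b : L) : set S :=
  [set s | digits s n = i /\ a < val (position s) < b].

Lemma tube_open n i a b : open (@tube n i a b).
Proof.
pose B : set (Sigma L (w n)) :=
  [set s | (coord b0 (winding_gt0 p_gt0 n) s).1 = i /\
           a < val (coord b0 (winding_gt0 p_gt0 n) s).2 < b].
have -> : @tube n i a b = (fun s : S => val s n : Sigma L (w n)) @^-1` B.
  apply/seteqP; split=> s; rewrite /tube /B /=.
    by rewrite (positionE b0_min).
  by rewrite (positionE b0_min).
apply: open_comp => [s _|]; first exact: continuous_proj.
apply/(open_SigmaP b0_min (winding_gt0 p_gt0 n)) => j.
have -> : circle_arc b0 j @^-1` B =
    [set y : order_topology L | j = i] `&` [set y | a < y < b].
  apply/seteqP; split=> y; rewrite /B /=; have [yt|/negPn/eqP ->] := boolP (y != \top).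
  - have [z ->] := minus_lastP yt.
    by rewrite arcE (circle_ptK b0_min).
  - by rewrite arc_top (circle_ptK b0_min) /= ltNge b0_min => -[].
  - have [z ->] := minus_lastP yt.
    by rewrite arcE (circle_ptK b0_min).
  - by move=> [_ /andP[_]]; rewrite ltNge lex1.
apply: openI; last by have := @itv_open _ (order_topology L) a b; rewrite set_itvE.
have [ji|nji] := pselect (j = i).
  have -> : [set y : order_topology L | j = i] = setT by apply/seteqP; split=> /=.
  exact: openT.
have -> : [set y : order_topology L | j = i] = set0 by apply/seteqP; split=> /=.
exact: open0.
Qed.

(** Where the position stays in an open interval of [L], every digit is locally
    constant. *)
Lemma connected_digits (C : set S) s t a b : connected C ->
  C `<=` [set u | a < val (position u) < b] -> C s -> C t -> digits s = digits t.
Proof.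
move=> Cc Cab Cs Ct; apply: functional_extensionality_dep => n.
suff : C t -> (C `&` @tube n (digits s n) a b) t by case=> // _ [->].
rewrite (Cc (C `&` tube (digits s n) a b)) //.
- by exists s; split=> //; split=> //; exact: Cab.
- by exists (tube (digits s n) a b) => //; exact: tube_open.
- exists (~` \bigcup_(i in [set i | i <> digits s n]) @tube n i a b).
    rewrite closedC; apply: bigcup_open => i _; exact: tube_open.
  apply/seteqP; split=> u [Cu].
    by move=> [ui _]; split=> // -[i /= ni [ui' _]]; apply: ni; rewrite -ui'.
  move=> nu; split=> //; split; last exact: Cab.
  apply: contrapT => ni; apply: nu; exists (digits u n) => //.
  by split=> //; exact: Cab.
Qed.

Lemma thread_open_left g (gP : digits_compatible g) (U : set S) (z : L) : open U ->
  U (thread b0 gP z) -> extends_left (thread b0 gP @^-1` U) z.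
Proof.
move=> Uo Uz; have : open (thread b0 gP @^-1` U : set (order_topology L)).
  by apply: open_comp => // y _; exact: (thread_continuous b0_min p_gt0).
by move=> /order_openP/(_ z Uz)[].
Qed.

Lemma thread_open_right g (gP : digits_compatible g) (U : set S) (z : L) : open U ->
  U (thread b0 gP z) -> extends_right (thread b0 gP @^-1` U) z.
Proof.
move=> Uo Uz; have : open (thread b0 gP @^-1` U : set (order_topology L)).
  by apply: open_comp => // y _; exact: (thread_continuous b0_min p_gt0).
by move=> /order_openP/(_ z Uz)[].
Qed.

(** The first point of a thread is the last point of another one, which gives
    access to its left neighbourhoods. *)
Lemma thread_pred g (gP : digits_compatible g) :
  exists g' (gP' : digits_compatible g'), thread b0 gP' \top = thread b0 gP (val b0).
Proof.
pose g' n := rot (w n).-1 (g n).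
have wn n := winding_gt0 p_gt0 n.
have gP' : digits_compatible g'.
  move=> n; rewrite /g' -(gP n); apply: cover_ord_rot.
  apply/eqP; rewrite -(eqn_modDr 1) !addn1 !prednK //.
  by rewrite -[w n.+1]/(p n * w n)%N modnMl modnn.
exists g', gP'; apply: val_inj; apply: functional_extensionality_dep => n /=.
rewrite arc_top arcE; congr circle_pt; apply: val_inj => /=.
rewrite -addn1 modnDml -addnA addn1 prednK // modnDr modn_small //.
Qed.

Lemma thread_neq g (gP : digits_compatible g) (c z : L) :
  val b0 < c -> c < z -> thread b0 gP c <> thread b0 gP z.
Proof.
move=> bc cz /(congr1 position).
have [c' cE] := minus_last_below cz.
rewrite cE (position_thread b0_min); have [zt|/negPn/eqP ->] := boolP (z != \top).
  have [z' zE] := minus_lastP zt.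
  rewrite zE (position_thread b0_min) => cz'; move: cz.
  by rewrite cE zE cz' ltxx.
rewrite (position_thread_top b0_min) => cb.
by move: bc; rewrite cE cb ltxx.
Qed.

(** Each of countably many neighbourhoods of the point contains the piece of the
    thread between some [e n < z] and [z]; the [e n] stay below some [c < z], so
    the neighbourhoods have further points of the thread in common. *)
Lemma thread_not_Gdelta g (gP : digits_compatible g) (z : L) : val b0 < z ->
  (forall e : nat -> L, (forall n, e n < z) -> exists2 c, c < z & forall n, e n <= c) ->
  ~ Gdelta [set thread b0 gP z].
Proof.
move=> bz zcof [F Fo FE].
have Fz i : F i (thread b0 gP z).
  have : (\bigcap_i F i) (thread b0 gP z) by rewrite -FE.
  by apply.
have /choice[e eP] i : exists a, a < z /\
    forall y, a < y -> y <= z -> F i (thread b0 gP y).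
  by have [a az aF] := thread_open_left (Fo i) (Fz i) bz; exists a.
have [|c cz ec] := zcof e; first by move=> n; have [] := eP n.
have [c' /andP[cc' c'z]] := ranked_dense rP cz.
apply: (@thread_neq _ gP _ _ (le_lt_trans (b0_min c) cc') c'z).
suff : [set thread b0 gP z] (thread b0 gP c') by [].
rewrite FE => i _; have [_] := eP i; apply; last exact: ltW.
exact: le_lt_trans (ec i) cc'.
Qed.

(** Points of the next lower rank are found on the right of the point, and the
    segment of the thread that joins them to it is the connected set. *)
Lemma wild_of_rank k g (gP : digits_compatible g) (x : M) :
  r (val x) = k.+1 -> wild k (thread b0 gP (val x)).
Proof.
elim: k x => [|k IHk] x rx /=.
  have := ranked_cofinal rP (valP x) rx; case: ifP => [/eqP xb /= tcof|xb /= xcof].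
    have [g' [gP' <-]] : exists g' (gP' : digits_compatible g'),
        thread b0 gP' \top = thread b0 gP (val x) by rewrite xb; exact: thread_pred.
    by apply: thread_not_Gdelta => //; exact: minus_last_lt.
  apply: thread_not_Gdelta => //.
  by rewrite lt_neqAle b0_min andbT eq_sym xb.
move=> U Uo Ux.
have [b xb bU] := thread_open_right Uo Ux (minus_last_lt x).
have [|y /andP[xy yb] ry] := ranked_right rP (valP x) _ xb; first by rewrite rx.
have [y' yE] := minus_last_below yb.
exists (thread b0 gP @` [set z | val x <= z <= y]); split.
- exact: (connected_thread b0_min p_gt0 (ranked_dense rP) (ranked_complete rP)).
- by move=> _ [z /= /andP[xz zy] <-]; apply: bU => //; exact: le_lt_trans yb.
- by exists (val x); rewrite //= lexx ltW.
- exists (thread b0 gP y); first by exists y; rewrite //= lexx ltW.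
  split; last by rewrite yE; apply: IHk; rewrite -yE ry rx.
  move=> /(congr1 position); rewrite yE !(position_thread b0_min) => yx.
  by move: xy; rewrite yE yx ltxx.
Qed.

(** The [n]-th open set fixes the [n]-th digit and bounds the position by the
    [n]-th term of a sequence that separates [x] from all other positions. *)
Lemma thread_Gdelta g (gP : digits_compatible g) (x : M) :
  r (val x) = 0 -> Gdelta [set thread b0 gP (val x)].
Proof.
move=> rx; have [e [el er]] := ranked_separated rP (valP x) rx.
have xb : val b0 < val x.
  rewrite lt_neqAle b0_min andbT; apply/eqP => bx.
  by have := ranked_gt0 rP; rewrite -(ranked_first rP) bx rx.
pose a n := if e n < val x then e n else val b0.
pose b n := if val x < e n then e n else \top.
exists (fun n => @tube n (g n) (a n) (b n)) => [n|]; first exact: tube_open.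
apply/seteqP; split=> s /=.
  move=> -> n _; split; first by rewrite (digits_thread b0_min).
  rewrite (position_thread b0_min) /a /b.
  by case: ifP => [->|_]; case: ifP => [->|_]; rewrite ?xb ?minus_last_lt.
move=> sT; apply: (@solenoid_eq _ _ b0 p b0_min p_gt0).
  apply: functional_extensionality_dep => n; rewrite (digits_thread b0_min).
  by have [] := sT n I.
rewrite (position_thread b0_min); apply: val_inj.
have [sx|xs|//] := ltgtP (val (position s)) (val x).
  have [n /andP[sn nx]] := el _ sx.
  have [_ /andP[+ _]] := sT n I.
  by rewrite /a nx ltNge sn.
have [n /andP[xn ns]] := er _ xs.
have [_ /andP[_]] := sT n I.
by rewrite /b xn ltNge ns.
Qed.

(** A wild point near [x] on its thread has smaller rank than [x] by
    [ranked_near], unless [x] is the first point of [L], where the rank is [K]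
    and the conclusion is the hypothesis on [k]. *)
Lemma rank_of_wild k g (gP : digits_compatible g) (x : M) :
  (k < K)%N -> wild k (thread b0 gP (val x)) -> (k < r (val x))%N.
Proof.
elim: k g gP x => [|k IHk] g gP x kK /=.
  by move=> nG; rewrite lt0n; apply/eqP => rx; apply: nG; exact: thread_Gdelta.
have [-> _|xb] := eqVneq (val x) (val b0); first by rewrite (ranked_first rP).
have [a [b [axb ab]]] := ranked_near rP (valP x) xb.
pose U : set S := \bigcup_(i in setT) @tube 0 i a b.
have UE s : U s <-> a < val (position s) < b.
  by split=> [[i _ []]//|sab]; exists (digits s 0).
have Uo : open U by apply: bigcup_open => i _; exact: tube_open.
move=> /(_ U Uo)[|C [Cc CU Cx [z Cz [zx zk]]]].
  by apply/UE; rewrite (position_thread b0_min).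
have CU' : C `<=` [set u | a < val (position u) < b] by move=> u /CU/UE.
have ixz := connected_digits Cc CU' Cz Cx.
have zE : z = thread b0 gP (val (position z)).
  apply: (@solenoid_eq _ _ b0 p b0_min p_gt0).
    by rewrite ixz !(digits_thread b0_min).
  by rewrite (position_thread b0_min).
have kz : (k < r (val (position z)))%N.
  by apply: (IHk _ gP); [exact: ltnW|rewrite -zE].
have [||zr|zr] := ab (val (position z)).
- exact: CU'.
- apply/eqP => pz; apply: zx; rewrite zE; congr thread.
  by rewrite pz.
- exact: leq_ltn_trans zr.
- by rewrite zr in kz.
Qed.

Lemma rank_le x : x != \top -> (r x <= K)%N.
Proof.
move=> xt; have [->|xb] := eqVneq x (val b0); first by rewrite (ranked_first rP).
exact/ltnW/(ranked_lt rP).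
Qed.

(** The ranks are met in decreasing order, starting from the first point: the
    right side of a point of rank j + 1 contains points of rank j. *)
Lemma rank_attained j : (j <= K)%N -> exists x : M, r (val x) = j.
Proof.
move=> /subnK; move: (K - j)%N => m.
elim: m j => [|m IHm] j jK; first by exists b0; rewrite (ranked_first rP) -jK.
have [|x rx] := IHm j.+1; first by rewrite addnS -addSn.
case: j jK rx => [|j] jK rx.
  have [xb|xb] := eqVneq (val x) (val b0).
    have [y /andP[by_ yt]] := ranked_dense rP (minus_last_lt b0).
    have [y' yE] := minus_last_below yt; exists y'; rewrite -yE.
    have K1 : K = 1 by rewrite -(ranked_first rP) -xb.
    have := ranked_lt rP (_ : y != \top) (_ : y != val b0); rewrite K1 ltnS leqn0.
    by rewrite lt_eqF // gt_eqF // => /(_ isT isT)/eqP.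
  have [a [b [/andP[ax xb'] ab]]] := ranked_near rP (valP x) xb.
  have [y /andP[xy yb]] := ranked_dense rP xb'.
  have [y' yE] := minus_last_below yb; exists y'; rewrite -yE.
  have yab : a < y < b by rewrite yb (lt_trans ax).
  by have [||//] := ab y yab; rewrite ?gt_eqF // rx; case: (r y).
have [|y /andP[xy yb] ry] := ranked_right rP (valP x) _ (minus_last_lt x).
  by rewrite rx.
have [y' yE] := minus_last_below yb; exists y'.
by rewrite -yE ry rx.
Qed.

Lemma Homeo_rank f (s : S) : Homeo S f ->
  r (val (position (f s))) = r (val (position s)).
Proof.
have half f' (t : S) : Homeo S f' ->
    (r (val (position (f' t))) <= r (val (position t)))%N.
  move=> f'H; case E : (r (val (position (f' t)))) => [//|k].
  have kd := wild_of_rank (digitsP b0_min p_gt0 (f' t)) E.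
  rewrite (threadK b0_min) in kd.
  have [f'' f''H f'K] := Homeo_inv f'H.
  have := wild_Homeo f''H kd; rewrite f'K -(threadK b0_min p_gt0 t).
  move=> /rank_of_wild; rewrite (position_thread b0_min); apply.
  by have := rank_le (valP (position (f' t))); rewrite E.
move=> fH; apply/anti_leq; rewrite half //=.
have [f' f'H fK] := Homeo_inv fH.
by rewrite -{1}(fK s) half.
Qed.

Theorem solenoid_recip_homogeneous : recip_homogeneous `I_(K.+1) S.
Proof.
rewrite /recip_homogeneous; apply: card_esym; apply/card_set_bijP.
have g0P : digits_compatible (fun n => Ordinal (winding_gt0 p_gt0 n)).
  by move=> n; apply: val_inj; rewrite /= mod0n.
have /choice[x xP] (j : nat) : exists x : M, (j <= K)%N -> r (val x) = j.
  have [/rank_attained[x xj]|] := boolP (j <= K)%N; last by exists b0.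
  by exists x.
exists (fun j => homeo_orbit (thread b0 g0P (val (x j)))); split.
- by move=> j _; exists (thread b0 g0P (val (x j))).
- move=> i j; rewrite !inE /= !ltnS => iK jK ij.
  have : homeo_orbit (thread b0 g0P (val (x j))) (thread b0 g0P (val (x j))).
    by exists id => //; exact: Homeo_id.
  rewrite -ij => -[f /Homeo_rank fr] /(congr1 (fun s => r (val (position s)))).
  by rewrite fr !(position_thread b0_min) !xP.
- move=> _ [s _ <-].
  have sK := rank_le (valP (position s)).
  exists (r (val (position s))); first by rewrite /= ltnS.
  have [F [G [FG Fx]]] : exists F G, order_aut F G /\
      F (val (x (r (val (position s))))) = val (position s).
    by apply: (ranked_aut rP (valP (x _)) (valP (position s))); rewrite /= xP.
  have [f fH] := thread_homeo b0_min p_gt0 g0P (digitsP b0_min p_gt0 s)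
    (x (r (val (position s)))) FG.
  by rewrite Fx (threadK b0_min) => /(congr1 (@homeo_orbit _)); rewrite homeo_orbit_eq.
Qed.

End orbits.

(** * Order automorphisms moving a point inside a separable interval *)

Definition dense_sequence d (T : orderType d) (f : nat -> T) (u v : T) :=
  forall a b, u <= a -> a < b -> b <= v -> exists n, a < f n < b.

(** The left-to-right order on the nodes of the infinite binary tree. *)
Fixpoint infix_lt (s t : seq bool) : bool :=
  match s, t with
  | [::], [::] => false
  | [::], c :: _ => c
  | c :: _, [::] => ~~ c
  | c :: s', c' :: t' => if c == c' then infix_lt s' t' else c'
  end.

Section enumeration_tree.
Context d (T : orderType d) (f : nat -> T).
Implicit Types (a b u v : T) (s t : seq bool).

Definition first_index a b : nat :=
  if pselect (exists n, a < f n < b) is left ex then ex_minn ex else 0.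

Definition first_in a b := f (first_index a b).

(** An interval is split at the first point of the sequence that it contains,
    and so are the two halves.  The nodes of the resulting tree are the terms of
    a dense sequence that lie in the interval, and their order depends only on the shape of the tree;
    so any two dense sequences span order-isomorphic sets (Cantor's theorem). *)
Fixpoint node a b s : T :=
  if s is c :: s' then
    if c then node (first_in a b) b s' else node a (first_in a b) s'
  else first_in a b.

Lemma first_indexP a b n : a < f n < b ->
  a < first_in a b < b /\ (first_index a b <= n)%N.
Proof.
rewrite /first_in /first_index => abn; case: pselect => [ex|[]]; last by exists n.
by case: ex_minnP => m abm mmin; split=> //; exact: mmin.
Qed.

Section dense.
Context (u v : T).
Hypothesis fP : dense_sequence f u v.

Lemma node_between a b s : u <= a -> a < b -> b <= v -> a < node a b s < b.
Proof.
elim: s a b => [|c s IHs] a b ua ab bv /=; have [n abn] := fP ua ab bv;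
  have [/andP[am mb] _] := first_indexP abn; first by rewrite am.
case: c.
  have /andP[ms ->] := IHs _ _ (le_trans ua (ltW am)) mb bv.
  by rewrite (lt_trans am).
have /andP[-> sm] := IHs _ _ ua am (le_trans (ltW mb) bv).
by rewrite (lt_trans sm).
Qed.

Lemma node_lt_infix a b s t : u <= a -> a < b -> b <= v ->
  infix_lt s t -> node a b s < node a b t.
Proof.
elim: s a b t => [|c s IHs] a b t ua ab bv; have [n abn] := fP ua ab bv;
  have [/andP[am mb] _] := first_indexP abn;
  have um := le_trans ua (ltW am); have mv := le_trans (ltW mb) bv.
  by case: t => [|[] t] //= _; have /andP[] := node_between t um mb bv.
case: t => [|c' t].
  by case: c => //= _; have /andP[] := node_between s ua am mv.
case: c c' => [] [] //=; first exact: IHs; last exact: IHs.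
move=> _; have /andP[_ sm] := node_between s ua am mv.
by have /andP[mt _] := node_between t um mb bv; exact: lt_trans mt.
Qed.

Lemma infix_lt_total s t : [|| infix_lt s t, s == t | infix_lt t s].
Proof. by elim: s t => [|[] s IHs] [|[] t] //=; exact: IHs. Qed.

Lemma node_lt a b s t : u <= a -> a < b -> b <= v ->
  (node a b s < node a b t) = infix_lt s t.
Proof.
move=> ua ab bv; apply/idP/idP; last exact: node_lt_infix.
have /or3P[//|/eqP ->|ts] := infix_lt_total s t; first by rewrite ltxx.
by rewrite ltNge ltW // node_lt_infix.
Qed.

(** Passing to the child interval that contains [f n] strictly increases the
    first index, which stays at most [n]; hence the descent reaches [f n]. *)
Lemma node_onto n a b : u <= a -> b <= v -> a < f n < b ->
  exists s, node a b s = f n.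
Proof.
move: {2}(n - first_index a b)%N (leqnn (n - first_index a b)%N) => m.
elim: m a b => [|m IHm] a b nm ua bv abn;
  have [/andP[am mb] mn] := first_indexP abn; have /andP[an nb] := abn.
  by exists [::]; rewrite /= /first_in; congr f; lia.
have first_neq a' b' : a <= a' -> b' <= b -> a' < f n < b' ->
    (b' <= first_in a b) || (first_in a b <= a') -> (n - first_index a' b' <= m)%N.
  move=> aa' bb' abn' out; have [/andP[am' mb'] mn'] := first_indexP abn'.
  have [_ mm'] := @first_indexP a b (first_index a' b')
    (introT andP (conj (le_lt_trans aa' am') (lt_le_trans mb' bb'))).
  (* The split point of [(a, b)] is no longer in [(a', b')]. *)
  have neq : first_index a b != first_index a' b'.
    apply/eqP => mE; move: out.
    by rewrite /first_in mE -!/(first_in _ _) !leNgt am' mb'.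
  have lt : (first_index a b < first_index a' b')%N by rewrite ltn_neqAle neq.
  rewrite -ltnS; apply: leq_trans nm.
  by apply: ltn_sub2l => //; exact: leq_trans lt mn'.
have [nf|fn|fn] := ltgtP (f n) (first_in a b); last by exists [::].
  have anf : a < f n < first_in a b by rewrite an.
  have [||s sE] := IHm a (first_in a b) _ ua _ anf.
  - by apply: first_neq; rewrite ?lexx // ltW.
  - exact: le_trans (ltW mb) bv.
  - by exists (false :: s).
have fnb : first_in a b < f n < b by rewrite fn.
have [||s sE] := IHm (first_in a b) b _ _ bv fnb.
- by apply: first_neq; rewrite ?lexx ?orbT // ltW.
- exact: le_trans ua (ltW am).
- by exists (true :: s).
Qed.

Lemma node_dense a b : u <= a -> a < b -> b <= v -> exists s, a < node u v s < b.
Proof.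
move=> ua ab bv; have [n abn] := fP ua ab bv.
have [|s sE] := @node_onto n u v (lexx _) (lexx _); last by exists s; rewrite sE.
by have /andP[an nb] := abn; rewrite (le_lt_trans ua) // (lt_le_trans nb).
Qed.

End dense.
End enumeration_tree.

Section cut_extension.
Context d (T : tOrderType d) (N : Type) (u v : T).
Hypothesis Tcomplete : order_complete T.

(** Families with the same order type which are dense in the interval from [u] to
    [v] determine the same cuts there; matching the cuts extends [P s |-> Q s] to
    the interval. *)
Definition cut_sup (P Q : N -> T) (z : T) : T :=
  sval (cid (Tcomplete [set Q s | s in [set s | P s < z]])).

Definition cut_map (P Q : N -> T) (z : T) : T :=
  if u < z < v then cut_sup P Q z else z.

Definition dense_family (P : N -> T) :=
  (forall s, u < P s < v) /\
  (forall a b, u <= a -> a < b -> b <= v -> exists s, a < P s < b).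

Lemma dense_family_eq (P : N -> T) (a b : T) : dense_family P ->
  u < a < v -> u < b < v -> (forall s, (P s < a) = (P s < b)) -> a = b.
Proof.
move=> [_ Pd] /andP[ua av] /andP[ub bv] ab.
have [ltab|ltba|//] := ltgtP a b.
  have [s /andP[as_ sb]] := Pd _ _ (ltW ua) ltab (ltW bv).
  by have := ab s; rewrite sb ltNge (ltW as_).
have [s /andP[bs sa]] := Pd _ _ (ltW ub) ltba (ltW av).
by have := ab s; rewrite sa ltNge (ltW bs).
Qed.

Section one_direction.
Context (P Q : N -> T).
Hypotheses (Pd : dense_family P) (Qd : dense_family Q).
Hypothesis PQ : forall s t, (P s < P t) = (Q s < Q t).

Lemma cut_mapP z s : u < z < v -> (P s < z) = (Q s < cut_map P Q z).
Proof.
move=> zuv; rewrite /cut_map zuv /cut_sup; case: cid => w /= [wub wlub].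
have /andP[uz zv] := zuv; have /andP[uPs Psv] := Pd.1 s.
apply/idP/idP => [sz|].
  have [t /andP[st tz]] := Pd.2 _ _ (ltW uPs) sz (ltW zv).
  by apply: (@lt_le_trans _ _ (Q t)); [rewrite -PQ|apply: wub; exists t].
apply: contraTT; rewrite -!leNgt => zs; apply: wlub => _ [t /= tz <-].
by rewrite ltW // -PQ (lt_le_trans tz).
Qed.

Lemma cut_map_between z : u < z < v -> u < cut_map P Q z < v.
Proof.
move=> zuv; have /andP[uz zv] := zuv.
have [s /andP[us sz]] := Pd.2 _ _ (lexx _) uz (ltW zv).
have [t /andP[zt tv]] := Pd.2 _ _ (ltW uz) zv (lexx _).
have /andP[uQs _] := Qd.1 s; have /andP[_ Qtv] := Qd.1 t.
rewrite (lt_trans uQs) -?cut_mapP //= (le_lt_trans _ Qtv) //.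
by rewrite leNgt -cut_mapP // ltNge ltW.
Qed.

Lemma cut_map_lt z w : z < w -> cut_map P Q z < cut_map P Q w.
Proof.
move=> zw; have [zuv|nz] := boolP (u < z < v); have [wuv|nw] := boolP (u < w < v).
- have /andP[uz _] := zuv; have /andP[_ wv] := wuv.
  have [s /andP[zs sw]] := Pd.2 _ _ (ltW uz) zw (ltW wv).
  apply: (@le_lt_trans _ _ (Q s)); last by rewrite -cut_mapP.
  by rewrite leNgt -cut_mapP // ltNge ltW.
- have /andP[_ zv] := cut_map_between zuv.
  rewrite (lt_le_trans zv) // /cut_map (negbTE nw).
  by move: nw; rewrite (lt_trans _ zw) ?(andP zuv).1 //= -leNgt.
- have /andP[uw _] := cut_map_between wuv.
  rewrite (le_lt_trans _ uw) // /cut_map (negbTE nz).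
  by move: nz; rewrite (lt_trans zw) ?(andP wuv).2 // andbT -leNgt.
- by rewrite /cut_map (negbTE nz) (negbTE nw).
Qed.

Lemma cut_map_family s : cut_map P Q (P s) = Q s.
Proof.
apply: (dense_family_eq Qd); [exact/cut_map_between/Pd.1|exact: Qd.1|].
by move=> t; rewrite -cut_mapP ?Pd.1 // PQ.
Qed.

End one_direction.

Lemma cut_mapK (P Q : N -> T) : dense_family P -> dense_family Q ->
  (forall s t, (P s < P t) = (Q s < Q t)) -> cancel (cut_map P Q) (cut_map Q P).
Proof.
move=> Pd Qd PQ z; have [zuv|nz] := boolP (u < z < v); last first.
  by rewrite /cut_map (negbTE nz) (negbTE nz).
have Fz := cut_map_between Pd Qd PQ zuv.
have QP s t : (Q s < Q t) = (P s < P t) by rewrite PQ.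
apply: (dense_family_eq Pd) => //; first exact: cut_map_between.
by move=> s; rewrite -(cut_mapP Qd QP) // -(cut_mapP Pd PQ).
Qed.

End cut_extension.

(** Putting [x], respectively [y], at the head of the sequence makes it the root of
    the tree, so that the isomorphism between the two trees maps [x] to [y]. *)
Lemma order_aut_between d (T : tOrderType d) (u v x y : T) (e : nat -> T) :
  order_complete T -> dense_sequence e u v -> u < x < v -> u < y < v ->
  exists F G, order_aut F G /\ F x = y.
Proof.
move=> Tc eP xuv yuv; have uv : u < v by case/andP: xuv => /lt_trans; apply.
pose from z n := if n is n'.+1 then e n' else z : T.
have fromP z : dense_sequence (from z) u v.
  by move=> a b ua ab bv; have [n] := eP a b ua ab bv; exists n.+1.
pose P z := node (from z) u v.
have P0 z : u < z < v -> P z [::] = z.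
  move=> zuv; have [_] := @first_indexP _ _ (from z) u v 0 zuv.
  by rewrite leqn0 /P /= /first_in => /eqP ->.
have Pd z : dense_family u v (P z).
  split=> [s|a b ua ab bv]; first exact: (node_between (fromP z)).
  exact: (node_dense (fromP z)).
have PQ z w s t : (P z s < P z t) = (P w s < P w t).
  by rewrite !(node_lt (fromP _)).
exists (cut_map u v Tc (P x) (P y)), (cut_map u v Tc (P y) (P x)); split.
  split; [exact: cut_mapK|exact: cut_mapK|exact: cut_map_lt].
by rewrite -{2}(P0 x xuv) cut_map_family // P0.
Qed.

(** * The long line *)

Section omega1_facts.

Lemma omega1_bounded (a : nat -> omega1) : exists g, forall n, a n < g.
Proof.
apply: contrapT => nog; apply: omega1_uncountable.
apply: (@sub_countable _ _ _ (\bigcup_n [set b | b <= a n])).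
  apply: subset_card_le => g _; apply: contrapT => ng; apply: nog; exists g => n.
  by rewrite ltNge; apply/negP => ga; apply: ng; exists n.
by apply: bigcup_countable => // n _; exact: omega1_countable_initial.
Qed.

Lemma omega1_initial_enum (a : omega1) :
  exists f : nat -> omega1, forall b, b <= a -> exists n, f n = b.
Proof.
have /countable_injP[f finj] := omega1_countable_initial a.
exists (fun n => xget a [set b | b <= a /\ f b = n]) => b ba; exists (f b).
case: xgetP => [c _ [ca fcb]|/(_ b)[]//].
by apply: finj; rewrite ?inE.
Qed.

Lemma omega1_min : exists o : omega1, forall a, o <= a.
Proof.
have [|o _ omin] := @omega1_well_ordered setT; last by exists o => a; exact: omin.
apply/set0P/eqP => T0; apply: omega1_uncountable.
by rewrite T0; exact: countable0.
Qed.

Definition omega1_first : omega1 := sval (cid omega1_min).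

Lemma omega1_first_min a : omega1_first <= a.
Proof. exact: (svalP (cid omega1_min)). Qed.

Lemma omega1_succ (a : omega1) : exists b, a < b /\ forall c, a < c -> b <= c.
Proof.
have [g ag] := omega1_bounded (fun=> a).
have [|b ab bmin] := @omega1_well_ordered [set b | a < b]; last by exists b.
by exists g; exact: (ag 0).
Qed.

End omega1_facts.

Section long_line.
Context (R : realType).
Local Notation LL := (closed_long_line R).
Implicit Types (a b : omega1) (t s : unit_co R).

Definition long_pt a t : LL := Some (a, t).

Lemma unit_co_bounds t : (0 <= val t < 1)%R.
Proof. exact: (valP t). Qed.

Lemma long_pt_le a t b s :
  (long_pt a t <= long_pt b s) = (a <= b) && ((b <= a) ==> (val t <= val s)%R).
Proof. by []. Qed.

Lemma long_pt_lt a t b s :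
  (long_pt a t < long_pt b s) = (a < b) || (a == b) && (val t < val s)%R.
Proof.
rewrite ltNge long_pt_le negb_and negb_imply -!ltNge.
by case: (ltgtP a b).
Qed.

Lemma long_ptP (x : LL) : x != \top -> exists a t, x = long_pt a t.
Proof. by case: x => [[a t]|] // _; exists a, t. Qed.

Fact unit_co0_subproof : (0 <= (0 : R) < (1 : R))%R.
Proof. by rewrite lexx ltr01. Qed.

Definition unit_co0 : unit_co R := exist (fun r : R => (0 <= r < 1)%R) _ unit_co0_subproof.

Definition to_unit_co (r : R) : unit_co R := insubd unit_co0 r.

Lemma val_to_unit_co (r : R) : (0 <= r < 1)%R -> val (to_unit_co r) = r.
Proof. by move=> r01; rewrite /to_unit_co insubdK. Qed.

Definition long_first : minus_last LL :=
  exist (fun x : LL => x != \top) (long_pt omega1_first unit_co0) isT.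

Lemma long_first_min (x : LL) : val long_first <= x.
Proof.
case: x => [[a t]|//].
by rewrite /= -/(long_pt omega1_first _) -/(long_pt a t) long_pt_le omega1_first_min /= (andP (unit_co_bounds t)).1 implybT.
Qed.

Lemma long_dense : densely_ordered LL.
Proof.
have above a t : exists s, (val t < val s)%R.
  have /andP[t0 t1] := unit_co_bounds t.
  exists (to_unit_co ((val t + 1) / 2)); rewrite val_to_unit_co; lra.
move=> x y xy; have xt : x != \top by rewrite lt_eqF // (lt_le_trans xy) // lex1.
have [a [t xE]] := long_ptP xt; subst x; have [s ts] := above a t.
case: y xy => [[b u]|] xy; last by exists (long_pt a s); rewrite long_pt_lt eqxx ts orbT.
have {}xy : long_pt a t < long_pt b u := xy.
rewrite -/(long_pt b u).
move: xy; rewrite long_pt_lt => /orP[ab|/andP[/eqP <- tu]].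
  by exists (long_pt a s); rewrite !long_pt_lt ab eqxx ts orbT.
have /andP[t0 t1] := unit_co_bounds t; have /andP[u0 u1] := unit_co_bounds u.
exists (long_pt a (to_unit_co ((val t + val u) / 2))).
have m01 : (0 <= (val t + val u) / 2 < 1)%R by lra.
have /andP[tm mu] : (val t < (val t + val u) / 2 < val u)%R by lra.
by rewrite !long_pt_lt eqxx val_to_unit_co // tm mu !orbT.
Qed.

(** A set bounded in the first coordinate has a least bound [g] there; its
    supremum is then on the segment that starts at [g], unless the second
    coordinates over [g] have supremum 1, when it is the successor of [g]. *)
Lemma long_complete : order_complete LL.
Proof.
move=> A; pose below g (x : LL) := exists a t, x = long_pt a t /\ a <= g.
have [[g0 gA]|nog] := pselect (exists g, forall x, A x -> below g x); last first.
  exists \top; split=> [x _|y yub]; first exact: lex1.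
  have [->//|/long_ptP[a [t yE]]] := eqVneq y \top.
  exfalso; apply: nog; exists a => x /yub; rewrite yE.
  case: x => [[b s]|//] xy; exists b, s; split=> //.
  by have : long_pt b s <= long_pt a t := xy; rewrite long_pt_le => /andP[].
have [|g gb gmin] := @omega1_well_ordered [set g | forall x, A x -> below g x].
  by exists g0.
have noub a t : a < g -> ~ ubound A (long_pt a t).
  move=> ag ub; have : g <= a; last by rewrite leNgt ag.
  apply: gmin => x Ax; have [b [s [xE _]]] := gb _ Ax; exists b, s; split=> //.
  by have := ub _ Ax; rewrite xE long_pt_le => /andP[].
have [[t At]|nt] := pselect (exists t, A (long_pt g t)); last first.
  exists (long_pt g unit_co0); split=> [x Ax|y yub].
    have [a [t [xE ag]]] := gb _ Ax.
    have ltag : a < g.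
      by rewrite lt_neqAle ag andbT; apply/eqP => aE; apply: nt; exists t; rewrite -aE -xE.
    by rewrite xE ltW // long_pt_lt ltag.
  have [->|/long_ptP[a [t yE]]] := eqVneq y \top; first exact: lex1.
  rewrite yE long_pt_le (andP (unit_co_bounds t)).1 implybT andbT leNgt.
  by apply/negP => ag; apply: (noub a t ag); rewrite -yE.
pose E : set R := [set val t | t in [set t | A (long_pt g t)]].
have E1 : ubound E 1%R by move=> _ [s _ <-]; have /andP[_ /ltW] := unit_co_bounds s.
have Esup : has_sup E by split; [exists (val t), t|exists 1%R].
have sub := sup_upper_bound Esup.
have s0 : (0 <= sup E)%R.
  apply: le_trans (sub (val t) _); last by exists t.
  by have /andP[] := unit_co_bounds t.
have [s1|s1] := ltP (sup E) 1%R.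
  have s01 : (0 <= sup E < 1)%R by rewrite s0.
  exists (long_pt g (to_unit_co (sup E))); split=> [x Ax|y yub].
    have [a [s [xE ag]]] := gb _ Ax.
    rewrite xE long_pt_le ag /=; apply/implyP => ga.
    rewrite val_to_unit_co //; apply: sub; exists s => //=.
    by have <- : a = g; [apply: le_anti; rewrite ag|rewrite -xE].
  have [->|/long_ptP[a [s yE]]] := eqVneq y \top; first exact: lex1.
  subst y; rewrite long_pt_le; apply/andP; split.
    by rewrite leNgt; apply/negP => ag; exact: (noub a s ag).
  apply/implyP => ag; rewrite val_to_unit_co //.
  apply: ge_sup; first by exists (val t), t.
  move=> _ [u /= Au <-]; have := yub _ Au; rewrite long_pt_le => /andP[ga].
  by rewrite ag.
have [g' [gg' g'min]] := omega1_succ g.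
exists (long_pt g' unit_co0); split=> [x Ax|y yub].
  have [a [s [xE ag]]] := gb _ Ax.
  by rewrite xE ltW // long_pt_lt (le_lt_trans ag).
have [->|/long_ptP[a [s yE]]] := eqVneq y \top; first exact: lex1.
subst y; rewrite long_pt_le (andP (unit_co_bounds s)).1 implybT andbT.
apply: g'min; have := yub _ At; rewrite long_pt_le => /andP[ga _].
rewrite lt_neqAle ga andbT; apply/eqP => gE; subst a.
have /andP[_] := unit_co_bounds s; rewrite ltNge => /negP; apply.
apply: le_trans s1 _; apply: ge_sup; first by exists (val t), t.
move=> _ [u /= Au <-]; have := yub _ Au.
by rewrite long_pt_le lexx.
Qed.

(** Below [a] there are countably many segments; the points with a rational second
    coordinate are dense in them. *)
Lemma long_dense_sequence a :
  exists e, dense_sequence e (val long_first) (long_pt a unit_co0).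
Proof.
have [f fP] := omega1_initial_enum a.
pose e n : LL := if @unpickle (nat * rat)%type n is Some (k, q)
  then long_pt (f k) (to_unit_co (ratr q)) else \top.
exists e => x y _ xy ya.
have [b [t xE]] : exists b t, x = long_pt b t.
  by apply: long_ptP; rewrite lt_eqF // (lt_le_trans xy) // lex1.
have [c [s yE]] : exists c s, y = long_pt c s.
  by apply: long_ptP; rewrite lt_eqF // (le_lt_trans ya).
subst x y; move: ya xy; rewrite long_pt_le long_pt_lt => /andP[ca _] bc.
have lebc : b <= c by case/orP: bc => [/ltW //|/andP[/eqP ->]].
have [k fk] := fP b (le_trans lebc ca).
have /andP[t0 t1] := unit_co_bounds t; have /andP[s0 s1] := unit_co_bounds s.
have [r [tr r1 rP]] : exists r : R, [/\ (val t < r)%R, (r <= 1)%R &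
    forall u, (val u < r)%R -> long_pt b u < long_pt c s].
  case/orP: bc => [bc|/andP[/eqP <- ts]].
    by exists 1%R; split=> // u _; rewrite long_pt_lt bc.
  by exists (val s); split=> //; [exact: ltW|move=> u us; rewrite long_pt_lt eqxx us orbT].
have [q] := rat_in_itvoo tr; rewrite in_itv /= => /andP[tq qr].
have {}tq : (val t < ratr q)%R := tq.
have q01 : (0 <= (ratr q : R) < 1)%R by lra.
exists (pickle (k, q)); rewrite /e pickleK fk rP ?val_to_unit_co // andbT.
by rewrite long_pt_lt eqxx val_to_unit_co // tq orbT.
Qed.

Definition long_rank (x : LL) : nat := x == val long_first.

Lemma long_line_ranked : ranked long_first long_rank 1.
Proof.
have bounded x : x != \top -> exists a, x < long_pt a unit_co0.
  move=> /long_ptP[a [t ->]]; have [b [ab _]] := omega1_succ a.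
  by exists b; rewrite long_pt_lt ab.
split.
- exact: long_first_min.
- exact: long_dense.
- exact: long_complete.
- by [].
- by rewrite /long_rank eqxx.
- by move=> x _ xb; rewrite /long_rank (negbTE xb).
- move=> x /bounded[a xa]; rewrite /long_rank; case: eqVneq => // xb _.
  have {}xb : val long_first < x by rewrite lt_neqAle eq_sym xb long_first_min.
  have [e eP] := long_dense_sequence a; exists e; split=> y yx.
    have [yb|yb] := leP (val long_first) y.
      by have [n /andP[yn nx]] := eP _ _ yb yx (ltW xa); exists n; rewrite ltW.
    by have := long_first_min y; rewrite leNgt yb.
  have [||n /andP[xn ny]] := eP x (Order.min y (long_pt a unit_co0)) (ltW xb).
  - by rewrite lt_min yx.
  - by rewrite ge_min lexx orbT.
  - by exists n; rewrite xn ltW // (lt_le_trans ny) // ge_min lexx.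
- move=> x _; rewrite /long_rank; case: eqVneq => // _ _ /= e eP.
  have /choice[a aP] n : exists a, e n < long_pt a unit_co0.
    by apply: bounded; rewrite lt_eqF.
  have [g ag] := omega1_bounded a; exists (long_pt g unit_co0) => // n.
  by rewrite ltW // (lt_trans (aP n)) // long_pt_lt ag.
- by move=> x _; rewrite /long_rank; case: eqP.
- move=> x xt xb; exists (val long_first), \top; split.
    by rewrite lt_neqAle eq_sym xb long_first_min lt_neqAle xt lex1.
  by move=> y /andP[yb _] _; right; rewrite /long_rank gt_eqF.
- move=> x y xt yt; rewrite /long_rank.
  case: eqVneq => [->|xb]; case: eqVneq => [->|yb] // _.
    by exists id, id; split=> //; split.
  have [a xa] := bounded _ xt; have [b yb'] := bounded _ yt.
  have [e eP] := long_dense_sequence (Order.max a b).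
  apply: (order_aut_between long_complete eP).
    rewrite lt_neqAle eq_sym xb long_first_min (lt_le_trans xa) //.
    by rewrite long_pt_le le_max lexx /= lexx implybT.
  rewrite lt_neqAle eq_sym yb long_first_min (lt_le_trans yb') //.
  by rewrite long_pt_le le_max lexx orbT /= lexx implybT.
Qed.

End long_line.

(** * The continua Lambda_n *)

Section next_Lambda.
Context (L : tOrderType long_display) (b0 : minus_last L) (r : L -> nat) (K : nat).
Hypothesis rP : ranked b0 r K.
Local Notation M := (minus_last L).
Local Notation T := (next_Lambda L).
Local Notation b0_min := (ranked_min rP).
Implicit Types (k l : int) (x y : M) (z : T).

Definition block_pt k x : T := Some (Some (k, x)).

Lemma block_pt_le k l x y :
  (block_pt k x <= block_pt l y) = (k <= l) && ((l <= k) ==> (val x <= val y)).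
Proof. by []. Qed.

Lemma block_pt_lt k l x y :
  (block_pt k x < block_pt l y) = (k < l) || (k == l) && (val x < val y).
Proof.
rewrite ltNge block_pt_le negb_and negb_imply -!ltNge.
by case: (ltgtP k l).
Qed.

Lemma block_pt_lt_same k x y : (block_pt k x < block_pt k y) = (val x < val y).
Proof. by rewrite block_pt_lt ltxx eqxx. Qed.

Lemma block_pt_le_same k x y : (block_pt k x <= block_pt k y) = (val x <= val y).
Proof. by rewrite block_pt_le lexx. Qed.

Definition next_first : minus_last T := exist (fun z : T => z != \top) None isT.

Lemma next_first_min z : val next_first <= z.
Proof. by []. Qed.

Variant next_spec : T -> Prop :=
| NextFirst : next_spec (val next_first)
| NextTop : next_spec \top
| NextBlock k x : next_spec (block_pt k x).

Lemma nextP z : next_spec z.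
Proof.
by case: z => [[[k x]|]|]; [exact: NextBlock|exact: NextTop|exact: NextFirst].
Qed.

Lemma first_lt_block k x : val next_first < block_pt k x.
Proof. by []. Qed.

(** The image in the block [k] of a point of [L], the last point of [L] being
    read as the first point of the following block. *)
Definition block_end k (y : L) : T :=
  if insub y is Some x then block_pt k x else block_pt (k + 1)%R b0.

Lemma block_end_val k x : block_end k (val x) = block_pt k x.
Proof. by rewrite /block_end valK. Qed.

Lemma block_end_top k : block_end k \top = block_pt (k + 1)%R b0.
Proof. by rewrite /block_end insubF ?eqxx. Qed.

Lemma block_pt_lt_end k x (y : L) : (block_pt k x < block_end k y) = (val x < y).
Proof.
have [/minus_lastP[y' ->]|/negPn/eqP ->] := boolP (y != \top).
  by rewrite block_end_val block_pt_lt_same.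
rewrite block_end_top block_pt_lt minus_last_lt (_ : k < (k + 1)%R) //; lia.
Qed.

Lemma block_end_le k (y : L) x : (block_end k y <= block_pt k x) = (y <= val x).
Proof. by rewrite !leNgt block_pt_lt_end. Qed.

Lemma block_end_lt_inv k x (y : L) z :
  block_pt k x <= z -> z < block_end k y -> exists2 x', z = block_pt k x' & val x' < y.
Proof.
case/nextP: z => [//||l x' kl le].
  by move=> _; rewrite ltNge lex1.
have lk : l = k.
  move: kl le; rewrite block_pt_le => /andP[kl _].
  have [/minus_lastP[y' ->]|/negPn/eqP ->] := boolP (y != \top).
    by rewrite block_end_val block_pt_lt; lia.
  rewrite block_end_top block_pt_lt [X in _ || _ && X]ltNge b0_min andbF; lia.
by subst l; exists x' => //; rewrite -(block_pt_lt_end k).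
Qed.

Lemma next_dense : densely_ordered T.
Proof.
have above k x : exists y, val x < val y.
  have [y /andP[xy /minus_last_below[y' yE]]] := ranked_dense rP (minus_last_lt x).
  by exists y'; rewrite -yE.
move=> z z'; case/nextP: z => [||k x]; case/nextP: z' => [||l y] //.
- by move=> _; exists (block_pt 0 b0).
- by move=> _; exists (block_pt (l - 1)%R b0); rewrite first_lt_block block_pt_lt; lia.
- by move=> _; have [y xy] := above k x; exists (block_pt k y); rewrite block_pt_lt_same xy.
- rewrite block_pt_lt => /orP[kl|/andP[/eqP <- xy]].
    by have [y' xy] := above k x; exists (block_pt k y'); rewrite block_pt_lt_same xy block_pt_lt kl.
  have [c /andP[xc cy]] := ranked_dense rP xy; have [c' cE] := minus_last_below cy.
  by exists (block_pt k c'); rewrite !block_pt_lt_same -cE xc.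
Qed.

(** Unless the blocks that a set meets are unbounded above, the supremum is taken
    in the last of them; if it is the last point of [L], it is the first point of
    the following block. *)
Lemma next_complete : order_complete T.
Proof.
move=> A; have [At|nAt] := pselect (A \top).
  by exists \top; split=> [z _|z]; [exact: lex1|exact].
have [[l [x Alx]]|noblock] := pselect (exists l x, A (block_pt l x)); last first.
  exists (val next_first); split=> [z Az|z _]; last exact: next_first_min.
  case/nextP: z Az => // k x Akx.
  by exfalso; apply: noblock; exists k, x.
have [[n nP]|unbounded] :=
    pselect (exists n : nat, forall k y, A (block_pt k y) -> k <= (l + n%:Z)%R); last first.
  exists \top; split=> [z _|z zub]; first exact: lex1.
  case/nextP: z zub => [/(_ _ Alx)||k y kub] //.
  exfalso; apply: unbounded; exists `|k - l|%N => j y' /kub.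
  by rewrite block_pt_le => /andP[jk _]; lia.
have [k [x0 [Ak kmax]]] : exists k x0,
    A (block_pt k x0) /\ forall j y, A (block_pt j y) -> j <= k.
  elim: n nP => [|n IHn] nP.
    by exists l, x; split=> // j y /nP; rewrite addr0.
  have [[y Ay]|noy] := pselect (exists y, A (block_pt (l + n.+1%:Z)%R y)).
    by exists (l + n.+1%:Z)%R, y; split.
  apply: IHn => j y Ajy; have := nP _ _ Ajy; rewrite le_eqVlt => /orP[/eqP jE|]; last lia.
  by exfalso; apply: noy; exists y; rewrite -jE.
have [s [sub slub]] := ranked_complete rP [set val y | y in [set y | A (block_pt k y)]].
exists (block_end k s); split=> [z Az|z zub].
  case/nextP: z Az => [_|//|j y Ajy].
    exact: next_first_min.
  have := kmax _ _ Ajy; rewrite (le_eqVlt j) => /orP[/eqP jk|jk].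
    have ys : val y <= s by apply: sub; exists y => //; rewrite -jk.
    rewrite jk; have [/minus_lastP[s' sE]|/negPn/eqP ->] := boolP (s != \top).
      by rewrite sE block_end_val block_pt_le_same -sE.
    by rewrite ltW // block_pt_lt_end minus_last_lt.
  have /ltW : block_pt j y < block_pt k x0 by rewrite block_pt_lt jk.
  move=> /le_trans; apply; have := sub (val x0) (ex_intro2 _ _ x0 Ak erefl).
  have [/minus_lastP[s' sE]|/negPn/eqP -> _] := boolP (s != \top).
    by rewrite sE block_end_val block_pt_le_same.
  by rewrite ltW // block_pt_lt_end minus_last_lt.
have [kz|zk] := leP (block_end k \top) z.
  apply: le_trans kz; have [/minus_lastP[s' ->]|/negPn/eqP -> //] := boolP (s != \top).
  by rewrite block_end_val ltW // block_pt_lt_end minus_last_lt.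
have [y zE _] := block_end_lt_inv (zub _ Ak) zk; subst z.
rewrite block_end_le; apply: slub => _ [y' /= Ay' <-].
by have := zub _ Ay'; rewrite block_pt_le_same.
Qed.

Definition next_rank z : nat :=
  match z with
  | None => K.+1
  | Some None => 0
  | Some (Some (_, x)) => r (val x)
  end.

Lemma next_rank_block k x : next_rank (block_pt k x) = r (val x).
Proof. by []. Qed.

Lemma next_rank_first : next_rank (val next_first) = K.+1.
Proof. by []. Qed.

Definition next_aut (m : int) F G (FG : order_aut F G) z : T :=
  match z with
  | Some (Some (k, x)) => block_pt (k + m)%R (minus_last_map FG x)
  | _ => z
  end.

Lemma next_aut_order_aut m F G (FG : order_aut F G) (GF : order_aut G F) :
  order_aut (next_aut m FG) (next_aut (- m)%R GF).
Proof.
have [FK GK _] := FG.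
split.
- case/nextP=> //= k x; congr (block_pt _ _); first lia.
  by apply: val_inj; exact: FK.
- case/nextP=> //= k x; congr (block_pt _ _); first lia.
  by apply: val_inj; exact: GK.
- case/nextP=> [||k x]; case/nextP=> [||l y] //=.
  rewrite !block_pt_lt /= (order_aut_lt FG) => kl; lia.
Qed.

(** A point keeps the rank that it has in its block, and all properties of a point
    inside a block are inherited from [L]; the first point of a block sees on its
    left the end of the previous block.  The new first point is the limit of the
    first points of the blocks, which have rank [K]. *)
Lemma next_Lambda_ranked : ranked next_first next_rank K.+1.
Proof.
split.
- exact: next_first_min.
- exact: next_dense.
- exact: next_complete.
- by [].
- by [].
- by case/nextP=> //= k x _ _; rewrite ltnS (rank_le rP (valP x)).
- case/nextP=> // k x _; rewrite next_rank_block => rx.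
  have [e [el er]] := ranked_separated rP (valP x) rx.
  have xb : val b0 < val x.
    rewrite lt_neqAle b0_min andbT; apply/eqP => bx.
    by have := ranked_gt0 rP; rewrite -(ranked_first rP) bx rx.
  exists (fun n => block_end k (e n)); split=> y.
    have [yk yx|ky] := leP y (block_pt k b0).
      have [n /andP[bn nx]] := el _ xb; exists n; move: nx bn.
      move=> /[dup] /minus_last_below[c ->] cx bc.
      by rewrite block_end_val block_pt_lt_same cx andbT (le_trans yk) // block_pt_le_same.
    rewrite -block_end_val => /block_end_lt_inv -/(_ b0 (ltW ky))[y' -> yx].
    have [n /andP[bn nx]] := el _ yx; exists n; move: nx bn.
    move=> /[dup] /minus_last_below[c ->] cx bc.
    by rewrite !block_end_val block_pt_lt_same cx andbT block_pt_le_same.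
  have [yk|yk] := leP (block_end k \top) y.
    move=> xy; have [n /andP[xn nt]] := er _ (minus_last_lt x).
    exists n; rewrite block_pt_lt_end xn (le_trans _ yk) //.
    have [/minus_lastP[c ->]|/negPn/eqP -> //] := boolP (e n != \top).
    by rewrite block_end_val ltW // block_pt_lt_end minus_last_lt.
  move=> xy; have [y' yE xy'] := block_end_lt_inv (ltW xy) yk.
  have [|n /andP[xn nt]] := er (val y'); first by rewrite -(block_pt_lt_same k) -yE.
  by exists n; rewrite block_pt_lt_end xn yE block_end_le.
- case/nextP=> // [_ [E]|k x _].
    by have := ranked_gt0 rP; rewrite E.
  rewrite next_rank_block => rx /= e ek.
  have := ranked_cofinal rP (valP x) rx; case: ifP => [/eqP xb|/eqP/eqP xb] /= cof.
    (* To the left of the first point of a block is the end of the previous one. *)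
    pose f n : L := if e n is Some (Some (l, y)) then
      if l == (k - 1)%R then val y else val b0 else val b0.
    have [n|c ct fc] := cof f.
      rewrite /f; case: (e n) => [[[l y]|]|]; try exact: minus_last_lt.
      by case: ifP => _; exact: minus_last_lt.
    have [c' cE] := minus_last_below ct; exists (block_pt (k - 1)%R c').
      rewrite block_pt_lt; lia.
    move=> n; have := ek n; have := fc n; rewrite /f.
    case/nextP: (e n) => //= l y yc.
    have -> : x = b0 by exact: val_inj.
    rewrite block_pt_lt [X in _ && X]ltNge b0_min andbF orbF => lk.
    rewrite block_pt_le; apply/andP; split; first lia.
    by apply/implyP => lk'; move: yc; rewrite cE ifT //; lia.
  pose f n : L := if e n is Some (Some (l, y)) then
    if l == k then val y else val b0 else val b0.
  have bx : val b0 < val x by rewrite lt_neqAle eq_sym xb b0_min.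
  have [n|c cx fc] := cof f.
    rewrite /f; have := ek n; case/nextP: (e n) => //= l y.
    by rewrite block_pt_lt; case: eqVneq => // ->; rewrite ltxx.
  have [c' cE] := minus_last_below cx; exists (block_pt k c').
    by rewrite block_pt_lt_same -cE.
  move=> n; have := ek n; have := fc n; rewrite /f.
  case/nextP: (e n) => //= l y yc.
  rewrite block_pt_lt => lk; rewrite block_pt_le; apply/andP; split; first lia.
  by apply/implyP => lk'; move: yc; rewrite cE ifT //; lia.
- case/nextP=> // [_ _|k x _ rx] b.
    have rb : r (val b0) = K.+1.-1 by rewrite (ranked_first rP).
    case/nextP: b => [|_|l y _] //.
      by exists (block_pt 0 b0).
    exists (block_pt (l - 1)%R b0) => //.
    by rewrite first_lt_block block_pt_lt /=; lia.
  have [bk|kb] := leP (block_end k \top) b.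
    move=> _; have [y /andP[xy yt] ry] := ranked_right rP (valP x) rx (minus_last_lt x).
    have [y' yE] := minus_last_below yt; exists (block_pt k y'); last by rewrite next_rank_block -yE.
    by rewrite block_pt_lt_same -yE xy (lt_le_trans _ bk) // block_pt_lt_end minus_last_lt.
  move=> xb; have [b' bE _] := block_end_lt_inv (ltW xb) kb.
  have [|y /andP[xy yb] ry] := ranked_right rP (valP x) rx (_ : _ < val b').
    by rewrite -(block_pt_lt_same k) -bE.
  have [y' yE] := minus_last_below yb; exists (block_pt k y'); last by rewrite next_rank_block -yE.
  by rewrite bE !block_pt_lt_same -yE xy.
- case/nextP=> // k x _ _.
  have [xb|xb] := eqVneq x b0.
    exists (block_pt (k - 1)%R b0), (block_pt (k + 1)%R b0).
    split; first by rewrite xb !block_pt_lt; lia.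
    case/nextP=> // l y /andP[ky yk] yx; left; rewrite !next_rank_block xb.
    rewrite (ranked_first rP); apply: (ranked_lt rP (valP y)).
    apply/eqP => /val_inj yb; move: ky yk yx; rewrite yb xb !block_pt_lt ltxx !andbF !orbF => k1 k2.
    by have -> : l = k by [lia]; rewrite eqxx.
  have [a [b [/andP[ax xb'] ab]]] := ranked_near rP (valP x) xb.
  have [a' aE] := minus_last_below ax.
  exists (block_pt k a'), (block_end k b); split.
    by rewrite block_pt_lt_same -aE ax block_pt_lt_end.
  move=> z /andP[az zb]; have [y zE yb] := block_end_lt_inv (ltW az) zb.
  subst z => yx; rewrite !next_rank_block; apply: ab.
    by rewrite aE yb andbT -(block_pt_lt_same k).
  by apply: contra_neq yx => /val_inj ->.
- move=> z z'; case/nextP: z => [_||k x _] //; case/nextP: z' => [_||l y _] //.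
  + by exists id, id; split=> //; split.
  + move=> /esym rE; have := rank_le rP (valP y).
    by rewrite -(next_rank_block l) rE next_rank_first ltnn.
  + move=> rE; have := rank_le rP (valP x).
    by rewrite -(next_rank_block k) rE next_rank_first ltnn.
  + rewrite !next_rank_block => rxy.
    have [F [G [FG Fx]]] := ranked_aut rP (valP x) (valP y) rxy.
    exists (next_aut (l - k)%R FG), (next_aut (- (l - k))%R (order_aut_sym FG)).
    split; first exact: next_aut_order_aut.
    rewrite /=; congr (block_pt _ _); first lia.
    exact: val_inj.
Qed.

End next_Lambda.

Lemma Lambda_ranked (R : realType) (kappa : nat) :
  exists b0 r, @ranked _ (Lambda R kappa.+1) b0 r kappa.+1.
Proof.
elim: kappa => [|k [b0 [r rP]]].
  exists (long_first R), (@long_rank R); exact: long_line_ranked.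
by exists (next_first (Lambda R k.+1)), (next_rank r k.+1); exact: next_Lambda_ranked rP.
Qed.

Theorem theorem2p5 (R : realType) (kappa : nat) (p : nat -> nat)
    (hkappa : (1 <= kappa)%N) (hp : forall n : nat, (2 <= p n)%N) :
  recip_homogeneous `I_(kappa.+1) (solenoid (Lambda R kappa) p).
Proof.
case: kappa hkappa => // kappa _.
have [b0 [r rP]] := Lambda_ranked R kappa.
by apply: (solenoid_recip_homogeneous rP) => n; exact: ltnW.
Qed.
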